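(* Let $\phi\colon A\to B$ be a surjective morphism of Weil algebras and let $I=\ker\phi$. For any smooth manifold $M$, the natural addition law of linear maps $(p^A,D)\mapsto p^A+D$ induces a structure of affine bundle on the fibre bundle $\hat\phi\colon M^A\to M^B$, $\hat\phi(p^A)=\phi\circ p^A$, if and only if $I^2=0$.
   Context: Manifolds are nonempty and $C^\infty$. A Weil algebra is a finite-dimensional local commutative $\mathbb R$-algebra with unit and residue field $\mathbb R$; morphisms are (unital) $\mathbb R$-algebra morphisms. For a Weil algebra $A$, $M^A$ is the set of $\mathbb R$-algebra morphisms $p^A\colon C^\infty(M)\to A$ ($A$-points of $M$), with its unique smooth manifold structure for which, for any basis $\{a_k\}$ of $A$ and any $f\in C^\infty(M)$, the functions $f_k$ defined by $p^A(f)=\sum_k f_k(p^A)a_k$ are smooth. For surjective $\phi$, $\hat\phi\colon M^A\to M^B$ is a fibre bundle. For $p^A\in M^A$ and an ideal $I\subseteq A$, $\mathrm{Der}_{p^A}(C^\infty(M),I)$ is the space of $\mathbb R$-linear maps $D\colon C^\infty(M)\to I$ with $D(fg)=p^A(f)D(g)+p^A(g)D(f)$; for $I=\ker\phi$ it is identified with the tangent space at $p^A$ of the fibre of $\hat\phi$ through $p^A$. ''The addition law induces a structure of affine bundle on $\hat\phi$'' means: for each $p^B\in M^B$ the space $\mathrm{Der}_{p^A}(C^\infty(M),I)$ is the same for all $p^A\in\hat\phi^{-1}(p^B)$; denoting it $TV_{p^B}$, these spaces are the fibres of a vector bundle over $M^B$; for all $p^A\in\hat\phi^{-1}(p^B)$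 and $D\in TV_{p^B}$ the linear map $p^A+D$ belongs to $\hat\phi^{-1}(p^B)$; and the resulting smooth map $(p^A,D)\mapsto p^A+D$ makes each fibre $\hat\phi^{-1}(p^B)$ an affine space modelled on $TV_{p^B}$.
   Formalization: The implication from ''affine bundle'' to I²=0 is stated for manifolds M of positive dimension only: if M is a point, the fibres are points and the derivation spaces vanish, so the addition law gives an affine bundle whatever I is. *)

(* Defs.v *)
From HB Require Import structures.
From mathcomp Require Import all_boot all_order all_algebra all_field.
From mathcomp Require Import all_classical all_reals all_analysis.
Set Implicit Arguments.
Unset Strict Implicit.
Unset Printing Implicit Defensive.
Import Order.TTheory GRing.Theory Num.Theory.
Import numFieldNormedType.Exports.
Local Open Scope classical_set_scope.
Local Open Scope ring_scope.

Section smooth_on.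
Context {R : realType} {E F : normedModType R}.

(* For [E] finite dimensional and [U] open, which is the only use made of it,
   [Ck k U f] says that [f] is of class C^k on [U]. *)
Fixpoint Ck (k : nat) (U : set E) (f : E -> F) : Prop :=
  match k with
  | 0 => forall x, U x -> {for x, continuous f}
  | k'.+1 => (forall x, U x -> differentiable f x) /\
             (forall v, Ck k' U ('D_v f))
  end.

Definition smooth_on (U : set E) (f : E -> F) : Prop := forall k, Ck k U f.

Lemma near_eq_differentiable (f g : E -> F) x :
  (\near x, f x = g x) -> differentiable f x -> differentiable g x.
Proof.
move=> fg /diff_locallyP[dfc dff].
have gE : g \o shift x = cst (g x) + 'd f x +o_ 0 id.
  apply/eqaddoP => e e0; move/eqaddoP: dff => /(_ e e0).
  have : \forall h \near (0 : E), f (h + x) = g (h + x).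
    by move: fg; rewrite (near_shift 0) subr0.
  apply: filterS2 => h fgh.
  by rewrite /= !fctE /= fgh (nbhs_singleton fg).
have dgE := diff_unique dfc gE.
by apply/diff_locallyP; rewrite dgE.
Qed.

Lemma Ck_sub k (U V : set E) f : V `<=` U -> Ck k U f -> Ck k V f.
Proof.
elim: k f => [|k IH] f VU /=; first by move=> fc x /VU; exact: fc.
by move=> [fd fD]; split=> [x /VU|v]; [exact: fd|exact: IH].
Qed.

Lemma Ck_eq k (U : set E) f g :
  open U -> (forall x, U x -> f x = g x) -> Ck k U f -> Ck k U g.
Proof.
move=> oU; elim: k f g => [|k IH] f g fg /=.
  move=> fc x Ux; rewrite /prop_for /continuous_at -(fg x Ux).
  by apply: cvg_trans (fc x Ux); apply: near_eq_cvg; near do apply: fg;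
    exact: open_nbhs_nbhs.
have nfg x : U x -> \near x, f x = g x.
  by move=> Ux; near do apply: fg; exact: open_nbhs_nbhs.
move=> [fd fD]; split=> [x Ux|v].
  exact: near_eq_differentiable (nfg _ Ux) (fd _ Ux).
by apply: IH (fD v) => x Ux; exact/near_eq_derive/nfg.
Unshelve. all: by end_near. Qed.

Lemma Ck_le k (U : set E) f : Ck k.+1 U f -> Ck k U f.
Proof.
elim: k f => [|k IH] f.
  by move=> [fd _] x Ux; apply: differentiable_continuous; exact: fd.
by move=> [fd fD]; split=> // v; apply: IH; exact: fD.
Qed.

Lemma Ck_cst k (U : set E) (a : F) : Ck k U (cst a).
Proof.
elim: k a => [|k IH] a /=; first by move=> x _; exact: cvg_cst.
split=> [x _|v]; first exact: differentiable_cst.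
suff -> : 'D_v (cst a) = cst 0 by [].
by apply/funext => x; rewrite derive_cst.
Qed.

Lemma CkD k (U : set E) f g : open U ->
  Ck k U f -> Ck k U g -> Ck k U (f + g).
Proof.
move=> oU; elim: k f g => [|k IH] f g /=.
  by move=> fc gc x Ux; apply: continuousD; [exact: fc|exact: gc].
move=> [fd fD] [gd gD]; split=> [x Ux|v].
  by apply: differentiableD; [exact: fd|exact: gd].
apply: Ck_eq (IH _ _ (fD v) (gD v)) => // x Ux.
by rewrite deriveD //; apply: diff_derivable; [exact: fd|exact: gd].
Qed.

End smooth_on.

Lemma CkM {R : realType} {E : normedModType R} k (U : set E) (f g : E -> R) :
  open U -> Ck k U f -> Ck k U g -> Ck k U (f * g).
Proof.
move=> oU; elim: k f g => [|k IH] f g.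
  by move=> fc gc x Ux; apply: continuousM; [exact: fc|exact: gc].
move=> /[dup] /Ck_le fk [fd fD] /[dup] /Ck_le gk [gd gD]; split=> [x Ux|v].
  by apply: differentiableM; [exact: fd|exact: gd].
apply: Ck_eq (CkD oU (IH _ _ fk (gD v)) (IH _ _ gk (fD v))) => // x Ux.
by rewrite deriveM //; apply: diff_derivable; [exact: fd|exact: gd].
Qed.

Record chart (X : Type) (E : Type) := Chart { cdom : set X; cmap : X -> E }.

(* A bare family of partial maps into [E]: the manifold axioms are [is_manifold]
   below. *)
Record atlas_space (R : realType) (E : normedModType R) := AtlasSpace {
  points :> Type;
  atlas : set (chart points E) }.

HB.instance Definition _ (R : realType) (E : normedModType R)
  (X : atlas_space E) := gen_eqMixin (points X).
HB.instance Definition _ (R : realType) (E : normedModType R)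
  (X : atlas_space E) := gen_choiceMixin (points X).

(* The topology induced by an atlas. *)
HB.instance Definition _ (R : realType) (E : normedModType R)
  (X : atlas_space E) := isSubBaseTopological.Build (points X)
    [set W | exists c : chart X E, exists O : set E,
       [/\ atlas c, open O & W = cdom c `&` cmap c @^-1` O]] id.

Section smooth_maps.
Context {R : realType}.

(* "F \o c^-1 is smooth on c(S)", for [S] contained in the domain of [c] (on
   which [c] is injective). *)
Definition smooth_via (X : Type) (E F : normedModType R) (c : chart X E)
    (S : set X) (f : X -> F) : Prop :=
  exists2 g : E -> F, smooth_on (cmap c @` S) g
                    & forall x, S x -> f x = g (cmap c x).

Definition smooth_fun (E F : normedModType R) (X : atlas_space E) (S : set X)
    (f : X -> F) : Prop :=
  forall c : chart X E, atlas c -> smooth_via c (cdom c `&` S) f.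

Definition smooth_map (E F : normedModType R) (X : atlas_space E)
    (Y : atlas_space F) (f : X -> Y) : Prop :=
  continuous f /\
  forall (c : chart X E) (d : chart Y F), atlas c -> atlas d ->
    smooth_via c (cdom c `&` f @^-1` cdom d) (cmap d \o f).

Definition compatible (X : Type) (E : normedModType R) (c d : chart X E) :=
  open (cmap c @` (cdom c `&` cdom d)) /\
  smooth_via c (cdom c `&` cdom d) (cmap d).

Definition is_manifold (E : normedModType R) (X : atlas_space E) : Prop :=
  [/\ [set: X] !=set0, hausdorff_space X, @second_countable X,
      forall x : X, exists2 c : chart X E, atlas c & cdom c x
    & forall c : chart X E, atlas c ->
        {in cdom c &, injective (cmap c)} /\
        forall d, atlas d -> compatible c d].

End smooth_maps.

(* Nonempty, Hausdorff, second countable, of constant dimension n. *)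
Record manifold (R : realType) (n : nat) := Manifold {
  manifold_space :> atlas_space 'rV[R]_n;
  manifoldP : is_manifold manifold_space }.

Section smooth_functions.
Context {R : realType} {n : nat} (M : manifold R n).

Definition Cinf_pred : {pred M -> R^o} := fun f => `[< smooth_fun setT f >].

Lemma open_chart (c : chart M 'rV[R]_n) : atlas c -> open (cmap c @` cdom c).
Proof.
have [_ _ _ _ H] := manifoldP M.
by move=> Ac; have [_ /(_ _ Ac)[]] := H _ Ac; rewrite setIid.
Qed.

Lemma Cinf_cst a : cst a \in Cinf_pred.
Proof. by apply/asboolP => c Ac; exists (cst a) => // k; exact: Ck_cst. Qed.

Lemma Cinf_mul f g : f \in Cinf_pred -> g \in Cinf_pred -> f * g \in Cinf_pred.
Proof.
move=> /asboolP fs /asboolP gs; apply/asboolP => c Ac.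
have [f' f's f'E] := fs c Ac; have [g' g's g'E] := gs c Ac.
exists (f' * g'); last by move=> x Sx; rewrite !fctE f'E // g'E.
by move=> k; apply: CkM => //; rewrite setIT; exact: open_chart.
Qed.

Lemma Cinf_add f g : f \in Cinf_pred -> g \in Cinf_pred -> f + g \in Cinf_pred.
Proof.
move=> /asboolP fs /asboolP gs; apply/asboolP => c Ac.
have [f' f's f'E] := fs c Ac; have [g' g's g'E] := gs c Ac.
exists (f' + g'); last by move=> x Sx; rewrite !fctE f'E // g'E.
by move=> k; apply: CkD => //; rewrite setIT; exact: open_chart.
Qed.

Lemma Cinf_scale : GRing.scaler_closed Cinf_pred.
Proof. by move=> a f fs; apply: Cinf_mul (Cinf_cst a) fs. Qed.

Lemma Cinf_subring_closed : subring_closed Cinf_pred.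
Proof.
split=> [|f g fs gs|]; [exact: Cinf_cst| |exact: Cinf_mul].
by apply: Cinf_add => //; rewrite -scaleN1r; exact: Cinf_scale.
Qed.

HB.instance Definition _ :=
  GRing.isSubringClosed.Build (M -> R^o) Cinf_pred Cinf_subring_closed.
HB.instance Definition _ :=
  GRing.isScaleClosed.Build R (M -> R^o) Cinf_pred Cinf_scale.

Record Cinf := MkCinf { cinf_fun :> M -> R^o; _ : cinf_fun \in Cinf_pred }.

HB.instance Definition _ := [isSub for cinf_fun].
HB.instance Definition _ := [Choice of Cinf by <:].
HB.instance Definition _ := GRing.SubChoice_isSubComPzRing.Build (M -> R^o)
  Cinf_pred Cinf Cinf_subring_closed.
HB.instance Definition _ := [SubZmodule_isSubLmodule of Cinf by <:].

Lemma Cinf_neq0 : (1 : Cinf) != 0.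
Proof.
have [[x _] _ _ _ _] := manifoldP M.
by apply/eqP => /(congr1 (fun f : Cinf => f x)) /eqP; rewrite oner_eq0.
Qed.
HB.instance Definition _ := GRing.PzSemiRing_isNonZero.Build Cinf Cinf_neq0.

Lemma Cinf_scaleAl (a : R) (f g : Cinf) : a *: (f * g) = a *: f * g.
Proof. by apply: val_inj; apply/funext => x; exact: mulrA. Qed.
HB.instance Definition _ := GRing.Lmodule_isLalgebra.Build R Cinf Cinf_scaleAl.
HB.instance Definition _ := GRing.Lalgebra_isComAlgebra.Build R Cinf.
End smooth_functions.

Section weil_bundles.
Context {R : realType}.

(* The non-units are closed under addition, and every class modulo the
   maximal ideal (the set of non-units) contains a scalar. *)
Definition weil_algebra (A : falgType R) : Prop :=
  [/\ forall a b : A, a * b = b * a,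
      forall a b : A, a \isn't a GRing.unit -> b \isn't a GRing.unit ->
        a + b \isn't a GRing.unit
    & forall a : A, exists c : R, a - c%:A \isn't a GRing.unit].

(* The charts of the maximal atlas. *)
Definition admissible_chart (E : normedModType R) (X : atlas_space E)
    (c : chart X E) : Prop :=
  [/\ {in cdom c &, injective (cmap c)}, open (cmap c @` cdom c)
    & forall d, atlas d -> compatible c d /\ compatible d c].

Context {n : nat} (M : manifold R n).

(* [u] is the point of M underlying the A-point [p]: modulo the maximal ideal
   of A, [p] is the evaluation at [u]. *)
Definition near_point (A : falgType R) (p : {lrmorphism Cinf M -> A}) (u : M) :=
  forall f : Cinf M, p f - (f u : R)%:A \isn't a GRing.unit.

(* The A-points of M. If functions x_1, ..., x_n in C^oo(M) restrict to a chart
   on U and (e_k) is a basis of A, the functions p |-> (x_i)_k(p), defined by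
   p(x_i) = \sum_k (x_i)_k(p) e_k, form a chart on the set of the A-points
   near the points of U.  These charts cover, since coordinates near a given
   point extend to C^oo(M).  They determine the structure for which all the
   functions f_k are smooth and, locally, some of them are coordinates. *)
Definition weil_bundle (A : falgType R) :
    atlas_space 'M[R]_(n, \dim {:A}) :=
  @AtlasSpace R 'M[R]_(n, \dim {:A}) {lrmorphism Cinf M -> A}
    [set C | exists (U : set M) (x : 'I_n -> Cinf M) (e : (\dim {:A}).-tuple A),
       [/\ admissible_chart (Chart U (fun u => \row_i (x i u : R))),
           basis_of {:A} e
         & C = Chart [set p | exists2 u, U u & near_point p u]
                 (fun p : {lrmorphism Cinf M -> A} =>
                    \matrix_(i, k) coord e k (p (x i)))]].

Definition weil_map (A B : falgType R) (phi : {lrmorphism A -> B})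
    (p : weil_bundle A) : weil_bundle B :=
  (phi \o (p : {lrmorphism Cinf M -> A})) : {lrmorphism Cinf M -> B}.

(* Der_p(C^oo(M), I). *)
Definition der (A : falgType R) (p : weil_bundle A) (I : {vspace A}) :
    set (Cinf M -> A) :=
  let p : {lrmorphism Cinf M -> A} := p in
  [set D | [/\ linear D, forall f, D f \in I
             & forall f g, D (f * g) = p f * D g + p g * D f]].

End weil_bundles.

Section bundles.
Context {R : realType} {E : normedModType R} {V : lmodType R}.

Record vb_chart (X : Type) (r : nat) := VBChart {
  vbdom : set X;
  vbmap : X -> V -> 'rV[R]_r }.

(* The subsets [T x] of [V] are the fibres of a vector bundle of rank [r], with
   local trivialisations (x, v) |-> (x, vbmap c x v) for [c] in [vb]. *)
Definition vector_bundle (X : atlas_space E) (T : X -> set V) (r : nat)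
    (vb : set (vb_chart X r)) : Prop :=
  [/\ forall x, T x 0 /\ forall a u v, T x u -> T x v -> T x (a *: u + v),
      forall x, exists2 c, vb c & vbdom c x,
      forall c, vb c -> open (vbdom c) /\
        forall x, vbdom c x ->
          set_bij (T x) setT (vbmap c x) /\
          forall a u v, T x u -> T x v ->
            vbmap c x (a *: u + v) = a *: vbmap c x u + vbmap c x v
    & forall c d, vb c -> vb d ->
        exists2 G : X -> 'M[R]_r, smooth_fun (vbdom c `&` vbdom d) G
          & forall x v, vbdom c x -> vbdom d x -> T x v ->
              vbmap d x v = vbmap c x v *m G x].

Definition total_space (X : atlas_space E) (T : X -> set V) (r : nat)
    (vb : set (vb_chart X r)) : atlas_space (E * 'rV[R]_r)%type :=
  @AtlasSpace R (E * 'rV[R]_r)%type {z : X * V | T z.1 z.2}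
    [set C | exists (c : chart X E) (d : vb_chart X r),
       [/\ atlas c, vb d
         & C = Chart [set z | (cdom c `&` vbdom d) (sval z).1]
                 (fun z => (cmap c (sval z).1,
                            vbmap d (sval z).1 (sval z).2))]].

(* Trivialisations of the bundle induced along [f], with fibres [T (f y)]. *)
Definition pullback (Y X : Type) (f : Y -> X) (r : nat)
    (vb : set (vb_chart X r)) : set (vb_chart Y r) :=
  [set VBChart (f @^-1` vbdom c) (vbmap c \o f) | c in vb].

(* [P] is an affine space modelled on the linear subspace [T] of [V], acting by
   the addition of [V]. *)
Definition affine_space (P T : set V) : Prop :=
  [/\ P !=set0, forall p v, P p -> T v -> P (p + v)
    & forall p q, P p -> P q -> exists! v, T v /\ q = p + v].

End bundles.
Arguments vb_chart {R} V X r.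

Section affine_bundle.
Context {R : realType} {n : nat} (M : manifold R n) {A B : falgType R}
  (phi : {lrmorphism A -> B}).

Definition ker : {vspace A} := lker (linfun phi).

Local Notation MA := (weil_bundle M A).
Local Notation MB := (weil_bundle M B).
Local Notation phihat := (@weil_map R n M A B phi).

Definition point_fun (p : MA) : Cinf M -> A := (p : {lrmorphism Cinf M -> A}).

(* [add] maps (p, D) to p + D, which it thereby requires to be an A-point over
   phihat p.  Its domain is the fibre product of MA and TV over MB, that is, the
   pairs (p, D) with D in TV_(phihat p). *)
Definition affine_bundle : Prop :=
  exists (TV : MB -> set (Cinf M -> A)) (r : nat)
         (vb : set (vb_chart (Cinf M -> A) MB r)),
    [/\ forall p : MA, der p ker = TV (phihat p),
        vector_bundle TV vb,
        exists2 add : total_space (TV \o phihat) (pullback phihat vb) -> MA,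
          smooth_map add
          & forall z, point_fun (add z) = point_fun (sval z).1 + (sval z).2 /\
                      phihat (add z) = phihat (sval z).1
      & forall b : MB,
          affine_space (point_fun @` (phihat @^-1` [set b])) (TV b)].

End affine_bundle.

(* Main.v *)
From HB Require Import structures.
Require Import Defs.
From mathcomp Require Import all_boot all_order all_algebra all_field.
From mathcomp Require Import all_classical all_reals all_analysis.
From mathcomp Require Import ring.

(** Write I for the kernel of [phi], and call a family of elements of A,
  indexed by
    the coordinates of a chart, coordinates of an A-point if they are its values
    at the coordinate functions.  Everything rests on two facts about A-points.

    An A-point is determined by its coordinates ([points_eq]),
      and coordinates can
    be prescribed freely, subject to their scalar parts being the coordinates
      of a
    point of the chart ([point_of_coords]).  For the first,
      Hadamard's lemma writes
    a function near a point [u] as [f u + \sum_i (x_i - x_i u) * g_i]; hence the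
    difference of two A-points with equal coordinates takes values in every
      power
    of the maximal ideal, and these powers vanish eventually.  For the second, a
    function is evaluated at the coordinates by expanding it in a Taylor series
      at
    the scalar parts along the nilpotent parts: the series is finite, and it is
    multiplicative because it is the exponential of a derivation ([prolong],
    [taylorM]).  By the first fact, the value of any A-point at a function is
    given by this formula ([prolong_eval]), so it depends smoothly on the
    coordinates ([prolong_wsmooth]); all smoothness claims reduce to this.  That
    every A-point lies near a point at all, so that charts apply to it,
      is Milnor's
    exercise ([near_point_ex]).

    If I ^+ 2 = 0, a derivation over [p] with values in I sees [p] only modulo
      I,
    so the spaces of derivations depend on [phi \o p] alone ([derE]).  For such
      a
    derivation D, the map p + D is multiplicative because [D f * D g = 0]
    ([add_point]), and conversely the difference of two A-points over the same
    B-point is a derivation ([sub_points]).  Lifting coordinates through [phi]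
    shows that A-points over every B-point exist, and comparing lifts shows that
    the values of a derivation at the coordinates can be prescribed freely in I
    ([derivation_ofP]).  These values are the trivialisations of the vector
      bundle.

    Conversely, let [a] be in I, and compare the evaluation at a point with the
    A-point that has one coordinate, x, moved by [a].  They lie over the same
    B-point.  If their difference is a derivation,
      then evaluating it at the square
    of x shows that [a ^+ 2 = 0] ([affine_sqr0]).  As 2 is invertible,
      I ^+ 2 = 0. *)

Set Implicit Arguments.
Unset Strict Implicit.
Unset Printing Implicit Defensive.
Import Order.TTheory GRing.Theory Num.Theory.
Import numFieldNormedType.Exports.
Local Open Scope classical_set_scope.
Local Open Scope ring_scope.

(** * Calculus of C^k maps *)

Section Ck_calculus.
Context {R : realType}.
Implicit Types E F G : normedModType R.

Lemma Ck_local k E F (U : set E) (f : E -> F) :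
  (forall x, U x -> exists2 V, open V /\ V x & Ck k V f) -> Ck k U f.
Proof.
elim: k f => [|k IH] f fU /=.
  by move=> x /fU[V [_ Vx]] fc; exact: fc.
split=> [x /fU[V [_ Vx]] [fd _]|v]; first exact: fd.
by apply: IH => x /fU[V oV [_ fD]]; exists V => //; exact: fD.
Qed.

Lemma Ck_post k E F G (U : set E) (f : E -> F) (L : {linear F -> G}) :
  open U -> continuous L -> Ck k U f -> Ck k U (L \o f).
Proof.
move=> oU Lc; elim: k f => [|k IH] f /=.
  by move=> fc x Ux; apply: continuous_comp; [exact: fc|exact: Lc].
have Ld y : differentiable L y by apply: linear_differentiable; exact: Lc.
move=> [fd fD]; split=> [x Ux|v].
  by apply: differentiable_comp; [exact: fd|].
apply: Ck_eq (IH _ (fD v)) => // x Ux.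
have fdx := fd x Ux.
rewrite /= !deriveE//; last exact: differentiable_comp.
by rewrite (diff_comp fdx (Ld _)) /= diff_lin.
Qed.

Lemma Ck_lin k E F (U : set E) (L : {linear E -> F}) :
  continuous L -> Ck k U L.
Proof.
move=> Lc; case: k => [|k] /=; first by move=> x _; exact: Lc.
have Ld y : differentiable L y by apply: linear_differentiable; exact: Lc.
split=> [//|v]; have -> : 'D_v L = cst (L v).
  by apply/funext => x; rewrite deriveE// diff_lin.
exact: Ck_cst.
Qed.

Lemma Ck_sum k E F (U : set E) I (r : seq I) (P : pred I) (f : I -> E -> F) :
  open U -> (forall i, P i -> Ck k U (f i)) ->
  Ck k U (fun x => \sum_(i <- r | P i) f i x).
Proof.
move=> oU fC.
rewrite (_ : (fun _ => _) = \sum_(i <- r | P i) f i); last first.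
  by apply/funext => x; rewrite fct_sumE.
by apply: (big_ind (Ck k U)) => //; [exact: Ck_cst|move=> ? ?; exact: CkD].
Qed.

Lemma Ck_scalel k E F (U : set E) (f : E -> R) (w : F) :
  open U -> Ck k U f -> Ck k U (fun x => f x *: w).
Proof.
move=> oU; elim: k f => [|k IH] f /=.
  by move=> fc x Ux; apply: cvgZr_tmp; exact: fc.
move=> [fd fD]; split=> [x Ux|v].
  by apply: differentiableZl; exact: fd.
apply: Ck_eq (IH _ (fD v)) => // x Ux.
have dx := fd x Ux.
by rewrite !deriveE//; [rewrite diffZl|exact: differentiableZl].
Qed.

Lemma Ck_mx k E (U : set E) a b (f : E -> 'M[R]_(a, b)) : open U ->
  (forall i j, Ck k U (fun x => f x i j : R)) -> Ck k U f.
Proof.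
move=> oU fC.
rewrite (_ : f = fun x => \sum_i \sum_j f x i j *: delta_mx i j); last first.
  by apply/funext => x; exact: matrix_sum_delta.
by do 2 (apply: Ck_sum => // ? _); exact: Ck_scalel.
Qed.

Lemma CkV k E (U : set E) (f : E -> R) : open U ->
  (forall x, U x -> f x != 0) -> Ck k U f -> Ck k U (fun x => (f x)^-1).
Proof.
move=> oU f0; elim: k f f0 => [|k IH] f f0.
  by move=> fc x Ux; apply: continuousV; [exact: f0|exact: fc].
move=> /[dup] /Ck_le/(IH _ f0) fV [fd fD]; split=> [x Ux|v].
  by apply: differentiableV; [exact: fd|exact: f0].
have mC : Ck k U (cst (-1) : E -> R) by exact: Ck_cst.
have H := CkM oU (CkM oU mC (CkM oU fV fV)) (fD v).
apply: Ck_eq H => // x Ux.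
rewrite deriveV//; [|exact: f0|by apply: diff_derivable; exact: fd].
by rewrite !fctE mulN1r -invfM -expr2.
Qed.

Lemma Ck_prod k E (U : set E) I (r : seq I) (P : pred I) (f : I -> E -> R) :
  open U -> (forall i, P i -> Ck k U (f i)) ->
  Ck k U (fun x => \prod_(i <- r | P i) f i x).
Proof.
move=> oU fC.
rewrite (_ : (fun _ => _) = \prod_(i <- r | P i) f i); last first.
  by apply/funext => x; rewrite fct_prodE.
apply: (big_ind (Ck k U : (E -> R) -> Prop)) => //; first exact: Ck_cst.
by move=> ? ?; exact: CkM.
Qed.

(** The chain rule needs only finitely many coordinates on the middle space:
    D_v (g o f) is a sum of products of a coordinate of D_v f and a partial
    derivative of g. *)
Lemma Ck_comp_basis E F (J : finType) (e : J -> F) (l : J -> {linear F -> R})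
    k (U : set E) (V : set F) (f : E -> F) (g : F -> R) :
  (forall j, continuous (l j)) -> (forall v, v = \sum_j l j v *: e j) ->
  open U -> open V -> (forall x, U x -> V (f x)) ->
  Ck k U f -> Ck k V g -> Ck k U (g \o f).
Proof.
move=> lc le oU oV fUV; elim: k f g fUV => [|k IH] f g fUV.
  move=> fc gc x Ux; apply: continuous_comp; [exact: fc|exact/gc/fUV].
move=> /[dup] /Ck_le fk [fd fD] /[dup] /Ck_le gk [gd gD]; split=> [x Ux|v].
  by apply: differentiable_comp; [exact: fd|exact/gd/fUV].
have K j : Ck k U (('D_(e j) g) \o f) by apply: IH fUV fk (gD _).
apply: Ck_eq (Ck_sum (index_enum J) (P:=xpredT) oU
  (fun j _ => CkM oU (Ck_post oU (lc j) (fD v)) (K j))) => // x Ux.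
have fdx := fd x Ux; have gdx := gd _ (fUV _ Ux).
rewrite [RHS]deriveE; last exact: differentiable_comp.
rewrite (diff_comp fdx gdx) /= [in RHS](le ('d f x v)) linear_sum;
  apply: eq_bigr => j _.
by rewrite linearZ/= !fctE/= !deriveE.
Qed.

Lemma Ck_comp1 E k (U : set E) (V : set R) (f : E -> R) (g : R -> R) :
  open U -> open V -> (forall x, U x -> V (f x)) ->
  Ck k U f -> Ck k V g -> Ck k U (g \o f).
Proof.
apply: (@Ck_comp_basis E R 'I_1 (fun=> 1) (fun=> idfun)).
- by move=> _ x; exact: cvg_id.
- by move=> v; rewrite big_ord1 /= [RHS]mulr1.
Qed.

Lemma coord_mx_continuous a b i j :
  continuous (fun A : 'M[R]_(a, b) => A i j).
Proof. by move=> x; apply: differentiable_continuous;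
  exact: differentiable_coord. Qed.

Definition mx_coord a b (i : 'I_a) (j : 'I_b) (A : 'M[R]_(a, b)) : R := A i j.

Lemma mx_coord_linear a b i j : linear (@mx_coord a b i j).
Proof. by move=> c u v; rewrite /mx_coord !mxE. Qed.
HB.instance Definition _ a b i j := GRing.isLinear.Build R 'M[R]_(a, b) R *:%R
  (@mx_coord a b i j) (@mx_coord_linear a b i j).

Lemma Ck_mx_coord k a b i j (U : set 'M[R]_(a, b)) : Ck k U (mx_coord i j).
Proof. by apply: Ck_lin; exact: coord_mx_continuous. Qed.

Lemma Ck_comp E n k (U : set E) (V : set 'rV[R]_n) (f : E -> 'rV[R]_n)
    (g : 'rV[R]_n -> R) :
  open U -> open V -> (forall x, U x -> V (f x)) ->
  Ck k U f -> Ck k V g -> Ck k U (g \o f).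
Proof.
apply: (@Ck_comp_basis E _ 'I_n (fun j => delta_mx 0 j) (fun j =>
  mx_coord 0 j)).
- by move=> j; exact: coord_mx_continuous.
- exact: row_sum_delta.
Qed.

Lemma Ck_addf k E F (U : set E) (f g : E -> F) : open U ->
  Ck k U f -> Ck k U g -> Ck k U (fun x => f x + g x).
Proof. exact: CkD. Qed.

Lemma Ck_mulf k E (U : set E) (f g : E -> R) : open U ->
  Ck k U f -> Ck k U g -> Ck k U (fun x => f x * g x).
Proof. exact: CkM. Qed.

Lemma Ck_id k E (U : set E) : Ck k U (fun x : E => x).
Proof. by apply: (@Ck_lin k E E U idfun) => x; exact: cvg_id. Qed.

Lemma Ck_oppf k E F (U : set E) (f : E -> F) : open U ->
  Ck k U f -> Ck k U (fun x => - f x).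
Proof.
by move=> oU; apply: (@Ck_post k E F F U f (GRing.opp : {linear F -> F})) =>
  // x;
  exact: opp_continuous.
Qed.

Lemma open_preimage E F (U : set E) (V : set F) (f : E -> F) :
  open U -> open V -> (forall x, U x -> {for x, continuous f}) ->
  open (U `&` f @^-1` V).
Proof.
move=> oU oV fc; rewrite openE => x [Ux Vfx]; apply: filterI.
  by apply: open_nbhs_nbhs.
by apply: fc => //; apply: open_nbhs_nbhs.
Qed.

End Ck_calculus.

(** * Smooth cut-off functions *)

Section cutoff_functions.
Context {R : realType}.

Lemma CkS_derive1 k (U : set R) (f f' : R -> R) : open U ->
  (forall x, U x -> is_derive x 1 f (f' x)) -> Ck k U f' -> Ck k.+1 U f.
Proof.
move=> oU ff' f'C.
have fd x : U x -> differentiable f x.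
  by move=> Ux; apply/derivable1_diffP; have [] := ff' x Ux.
split=> // v; apply: Ck_eq (CkM oU (Ck_cst k U v) f'C) => // x Ux.
rewrite deriveE; last exact: fd.
rewrite -[v in RHS]mulr1 -[v * 1]/(v *: 1) linearZ/= -deriveE; last exact: fd.
by have [_ ->] := ff' x Ux.
Qed.

(** The derivatives of the flat function [flat 0] are linear combinations of the
    functions [flat m], which is why the whole family is treated at once. *)
Definition flat (m : nat) (x : R) : R :=
  if 0 < x then x^-1 ^+ m * expR (- x^-1) else 0.

Lemma flat_le0 m x : x <= 0 -> flat m x = 0.
Proof. by rewrite /flat ltNge => ->. Qed.

Lemma flat_gt0 m x : 0 < x -> 0 < flat m x.
Proof.
by move=> x0; rewrite /flat x0 mulr_gt0 ?expR_gt0// exprn_gt0// invr_gt0.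
Qed.

Lemma flat_ge0 m x : 0 <= flat m x.
Proof.
by have [/flat_gt0/ltW|/flat_le0 ->] := ltP 0 x.
Qed.

(** With [y = x^-1], this is [y ^+ m.+1 / m.+1`! <= expR y].  It gives at once
    the continuity of [flat m] at 0 and, since the difference quotient of
    [flat m] at 0 is [flat m.+1], its differentiability there. *)
Lemma flat_bound m x : flat m x <= (m.+1)`!%:R * `|x|.
Proof.
have [x0|/flat_le0 ->] := ltP 0 x; last by rewrite mulr_ge0.
rewrite /flat x0 gtr0_norm// expRN ler_pdivrMr ?expR_gt0//.
have y0 : 0 < x^-1 by rewrite invr_gt0.
have fac0 : 0 < (m.+1)`!%:R :> R by rewrite ltr0n fact_gt0.
have H : x^-1 ^+ m.+1 / m.+1`!%:R <= expR x^-1.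
  by apply: le_trans (expR_ge1Dxn m (ltW y0)); rewrite lerDr.
have -> : x^-1 ^+ m = x * x^-1 ^+ m.+1 by rewrite exprS mulrA mulfV ?gt_eqF//
  mul1r.
by rewrite -mulrA mulrCA ler_pM2l// -ler_pdivrMl// mulrC.
Qed.

Lemma near_bound_cvg0 (f : R -> R) (C : R) :
  (forall x, `|f x| <= C * `|x|) -> f x @[x --> 0^'] --> (0 : R).
Proof.
move=> fC; apply/cvgrPdist_le => e e0.
have C0 : 0 < `|C| + 1 by rewrite ltr_wpDl.
near=> x; rewrite sub0r normrN; apply: le_trans (fC x) _.
have : C * `|x| <= (`|C| + 1) * `|x|.
  by rewrite ler_wpM2r// (le_trans (ler_norm _))// lerDl.
move=> /le_trans; apply; rewrite -ler_pdivlMl// mulrC.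
near: x; apply: dnbhs0_le; exact: divr_gt0.
Unshelve. all: by end_near. Qed.

Lemma is_derive_flat (m : nat) (x : R) :
  is_derive x (1 : R) (flat m) (flat m.+2 x - m%:R * flat m.+1 x).
Proof.
have [x0|x0|<-] := ltgtP 0 x.
- have fE : \near x, x^-1 ^+ m * expR (- x^-1) = flat m x.
    near=> y; rewrite /flat ifT//; near: y; exact: lt_nbhsr.
  apply: near_eq_is_derive fE _.
  have xn0 : x != 0 by rewrite gt_eqF.
  have dV : is_derive x (1 : R) (fun y : R => y^-1) (- x ^- 2 *: 1).
    by apply: is_deriveV.
  have dX := is_deriveX m dV.
  have dE : is_derive x (1 : R) (expR \o (- (fun y : R => y^-1)))
      (expR (- x^-1) * - (- x ^- 2 *: 1)).
    apply: (@is_derive1_comp R expR (- (fun y : R => y^-1)) x).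
  have -> : (fun y : R => y^-1 ^+ m * expR (- y^-1)) =
    ((fun y : R => y^-1) ^+ m * (expR \o (- (fun y : R => y^-1)))).
    by apply/funext => y; rewrite fctE/= exprfctE.
  apply: (is_derive_eq (is_deriveM dX dE)).
  rewrite /flat x0 /= exprfctE /= -![_ *: _]/(_ * _) -exprVn.
  rewrite -[(- (fun y : R => y^-1)) x]/(- x^-1).
  set y := x^-1; set E := expR _.
  case: m {dX} => [|m] /=; first by ring.
  by rewrite !exprS; ring.
- have fE : \near x, (cst 0 x : R) = flat m x.
    near=> y; rewrite flat_le0//; apply/ltW; near: y; exact: lt_nbhsl.
  apply: near_eq_is_derive fE _.
  rewrite !flat_le0 ?ltW// mulr0 subrr; exact: is_derive_cst.
- rewrite !flat_le0// mulr0 subr0.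
  have H : (fun h => h^-1 *: ((flat m \o shift 0) (h *: (1 :
    R)) - flat m 0)) @ 0^'
     --> (0 : R).
    rewrite (_ : (fun _ => _) = flat m.+1).
      by apply: (@near_bound_cvg0 _ (m.+2)`!%:R) => x0;
        rewrite ger0_norm ?flat_ge0//; exact: flat_bound.
    apply/funext => h; rewrite /= [_ *: 1]mulr1 addr0 (@flat_le0 _ 0)// subr0.
    rewrite /flat; case: ifP => _; last by rewrite scaler0.
    by rewrite exprS -mulrA.
  apply: DeriveDef; first by apply/cvg_ex; exists 0.
  exact: cvg_lim H.
Unshelve. all: by end_near. Qed.

Lemma Ck_flat k m : Ck k setT (flat m).
Proof.
elim: k m => [|k IH] m.
  move=> x _; apply: differentiable_continuous; apply/derivable1_diffP.
  by have [] := is_derive_flat m x.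
apply: CkS_derive1 (fun x _ => is_derive_flat m x) _; first exact: openT.
rewrite (_ : (fun _ => _) = flat m.+2 + cst (- m%:R) * flat m.+1); last first.
  by apply/funext => x; rewrite !fctE mulNr.
apply: CkD => //; first exact: openT.
by apply: CkM; [exact: openT|exact: Ck_cst|].
Qed.

(** A smooth cut-off: 1 on ]-oo, 1] and 0 on [2, +oo[. *)
Definition cutoff (t : R) : R := flat 0 (2 - t) / (flat 0 (2 - t) + flat 0 (t -
  1)).

Lemma cutoff_denom_gt0 t : 0 < flat 0 (2 - t) + flat 0 (t - 1).
Proof.
have [t2|t2] := ltP t 2.
  by apply: ltr_pwDl (flat_ge0 _ _); apply: flat_gt0; rewrite subr_gt0.
apply: ltr_wpDl (flat_ge0 _ _) _; apply: flat_gt0; rewrite subr_gt0.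
by apply: lt_le_trans t2; rewrite ltr1n.
Qed.

Lemma cutoff1 t : t <= 1 -> cutoff t = 1.
Proof.
move=> t1; have := cutoff_denom_gt0 t.
rewrite /cutoff (flat_le0 _ (x:=t - 1)) ?subr_le0// addr0 => /lt0r_neq0 H.
exact: mulfV.
Qed.

Lemma cutoff0 t : 2 <= t -> cutoff t = 0.
Proof. by move=> t2; rewrite /cutoff flat_le0 ?mul0r// subr_le0. Qed.

Lemma Ck_cutoff k : Ck k setT cutoff.
Proof.
have f1 : Ck k setT (fun t : R => flat 0 (2 - t)).
  apply: (@Ck_comp1 R _ k setT setT (fun t : R =>
    2 - t) (flat 0)) (Ck_flat k 0) => //; try exact: openT.
  apply: Ck_addf; [exact: openT|exact: Ck_cst|].
  by apply: Ck_oppf; [exact: openT|exact: Ck_id].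
have f2 : Ck k setT (fun t : R => flat 0 (t - 1)).
  apply: (@Ck_comp1 R _ k setT setT (fun t : R =>
    t - 1) (flat 0)) (Ck_flat k 0) => //; try exact: openT.
  by apply: Ck_addf; [exact: openT|exact: Ck_id|exact: Ck_cst].
apply: Ck_mulf => //; first exact: openT.
apply: CkV; first exact: openT.
  by move=> t _; rewrite gt_eqF// cutoff_denom_gt0.
by apply: Ck_addf => //; exact: openT.
Qed.

Lemma rV_norm_coord n (y : 'rV[R]_n) i : `|y 0 i| <= `|y|.
Proof.
rewrite [in leRHS]/Num.norm/= mx_normrE.
by apply: (@le_bigmax_cond _ _ _ _ (0, i) xpredT (fun ij => `|y ij.1 ij.2|)).
Qed.

Lemma rV_norm_coord_ex n (y : 'rV[R]_n) : 0 < `|y| -> exists i, `|y| = `|y 0 i|.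
Proof.
move=> y0; have [|[i j] /= H] := @mx_norm_neq0 _ _ _ y; first by rewrite gt_eqF.
by exists j; rewrite -[`|y|]/(mx_norm y) H (ord1 i).
Qed.

(** The norm of 'rV is the maximum norm, so a product over the coordinates
    separates two concentric balls, of radii [r] and [2 * r]. *)
Definition box_bump n (a : 'rV[R]_n) (r : R) (y : 'rV[R]_n) : R :=
  \prod_i cutoff (((y 0 i - a 0 i) / r) ^+ 2).

Lemma box_bump1 n (a : 'rV[R]_n) r y : 0 < r -> `|y - a| <= r ->
  box_bump a r y = 1.
Proof.
move=> r0 ya; apply: big1 => i _; apply: cutoff1.
rewrite -real_normK ?num_real// expr_le1// normrM normfV (gtr0_norm r0).
rewrite ler_pdivrMr// mul1r; apply: le_trans ya.
by have := rV_norm_coord (y - a) i; rewrite !mxE.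
Qed.

Lemma box_bump0 n (a : 'rV[R]_n) r y : 0 < r -> 2 * r <= `|y - a| ->
  box_bump a r y = 0.
Proof.
move=> r0 ya.
have [|i yi] := @rV_norm_coord_ex _ (y - a).
  by apply: lt_le_trans ya; rewrite mulr_gt0.
rewrite /box_bump (bigD1 i)//= cutoff0 ?mul0r//.
have : 2 <= `|(y 0 i - a 0 i) / r|.
  by rewrite normrM normfV (gtr0_norm r0) ler_pdivlMr//; move: ya;
    rewrite yi !mxE.
move=> h; rewrite -real_normK ?num_real// expr2.
apply: le_trans (h) _; apply: ler_peMr => //.
by apply: le_trans h; rewrite ler1n.
Qed.

Lemma Ck_box_bump k n (a : 'rV[R]_n) r : Ck k setT (box_bump a r).
Proof.
apply: Ck_prod => [|i _]; first exact: openT.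
apply: (@Ck_comp1 R _ k setT setT (fun y : 'rV[R]_n =>
  ((y 0 i - a 0 i) / r) ^+ 2)
  cutoff) (Ck_cutoff k) => //; try exact: openT.
have L : Ck k setT (fun y : 'rV[R]_n => (y 0 i - a 0 i) / r : R).
  apply: Ck_mulf; [exact: openT| |exact: Ck_cst].
  apply: Ck_addf; [exact: openT|exact: Ck_mx_coord|exact: Ck_cst].
by under eq_fun do rewrite expr2; apply: Ck_mulf => //; exact: openT.
Qed.

End cutoff_functions.

(** * Hadamard's lemma in R^n *)

Section unit_integral.
Context {R : realType}.
Implicit Types f g : R -> R.
Local Notation mu := (@lebesgue_measure R).

Definition unit_int f : R := (\int[mu]_(t in `[0%R, 1%R]) f t)%R.

Let mI : measurable (`[0%R, 1%R]%classic : set (measurableTypeR R)).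
Proof. exact: measurable_itv. Qed.

Lemma continuous_unit_integrable f : continuous f ->
  mu.-integrable `[0%R, 1%R] (EFin \o f).
Proof.
move=> fc; apply: continuous_compact_integrable; first exact: segment_compact.
exact: continuous_subspaceT.
Qed.

Lemma continuous_mulf f g : continuous f -> continuous g ->
  continuous (fun t => f t * g t).
Proof. by move=> fc gc t; apply: cvgM; [exact: fc|exact: gc]. Qed.

Lemma continuous_subf f g : continuous f -> continuous g ->
  continuous (fun t => f t - g t).
Proof. by move=> fc gc t; apply: cvgB; [exact: fc|exact: gc]. Qed.

Lemma continuous_cstf (c : R) : continuous (fun _ : R => c).
Proof. by move=> t; exact: cvg_cst. Qed.

Lemma unit_intD f g : continuous f -> continuous g ->
  unit_int (fun t => f t + g t) = unit_int f + unit_int g.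
Proof. by move=> fc gc; apply: RintegralD => //;
  exact: continuous_unit_integrable. Qed.

Lemma unit_intB f g : continuous f -> continuous g ->
  unit_int (fun t => f t - g t) = unit_int f - unit_int g.
Proof. by move=> fc gc; apply: RintegralB => //;
  exact: continuous_unit_integrable. Qed.

Lemma unit_intZ c f : continuous f ->
  unit_int (fun t => c * f t) = c * unit_int f.
Proof. by move=> fc; apply: RintegralZl => //;
  exact: continuous_unit_integrable. Qed.

Lemma unit_int_cst c : unit_int (cst c) = c.
Proof.
rewrite /unit_int Rintegral_cst//.
have -> : fine (mu `[0%R, 1%R]%classic) = 1.
  by rewrite lebesgue_measure_itv/= lte01 oppr0 adde0.
by rewrite mulr1.
Qed.

Lemma continuous_sumr n (f : 'I_n -> R -> R) : (forall i, continuous (f i)) ->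
  continuous (fun t => \sum_i f i t).
Proof.
move=> fc; rewrite (_ : (fun _ => _) = \sum_i f i); last first.
  by apply/funext => t; rewrite fct_sumE.
apply: (big_ind (fun h : R -> R => continuous h)) => //.
  by move=> x; exact: cvg_cst.
by move=> h k hc kc x; apply: continuousD; [exact: hc|exact: kc].
Qed.

Lemma unit_int_sum n (f : 'I_n -> R -> R) : (forall i, continuous (f i)) ->
  unit_int (fun t => \sum_i f i t) = \sum_i unit_int (f i).
Proof.
elim: n f => [|n IH] f fc.
  under eq_fun do rewrite big_ord0.
  by rewrite big_ord0 -[LHS]/(unit_int (cst 0)) unit_int_cst.
under eq_fun do rewrite big_ord_recl.
rewrite big_ord_recl unit_intD//; last exact: continuous_sumr.
by rewrite IH.
Qed.

Lemma unit_int_bound f e : continuous f ->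
  (forall t, 0 <= t <= 1 -> `|f t| <= e) -> `|unit_int f| <= e.
Proof.
move=> fc fe.
have fi := continuous_unit_integrable fc.
apply: le_trans (le_normr_Rintegral mI fi) _.
rewrite -[leRHS]unit_int_cst; apply: le_Rintegral => //.
- apply: continuous_unit_integrable => x.
  by apply: continuous_comp; [exact: fc|exact: norm_continuous].
- have cc : continuous (cst e : R -> R) by move=> x; exact: cvg_cst.
  exact: continuous_unit_integrable cc.
Qed.

Lemma unit_int_FTC f f' : (forall t : R, is_derive t (1 : R) f (f' t)) ->
  continuous f' -> unit_int f' = f 1 - f 0.
Proof.
move=> ff' f'c.
have fc : continuous f.
  by move=> t; apply: differentiable_continuous; apply/derivable1_diffP;
    have [] := ff' t.
rewrite /unit_int /Rintegral (@continuous_FTC2 _ f' f)//=.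
- exact: continuous_subspaceT.
- split.
  + by move=> t _; have [] := ff' t.
  + by apply: cvg_at_right_filter; exact: fc.
  + by apply: cvg_at_left_filter; exact: fc.
- by move=> t _; rewrite derive1E; have [_ ->] := ff' t.
Qed.

End unit_integral.

(** A form of the definition of the differential in which the remainder is a
    bound to be checked. *)
Lemma linear_approx_diff {R : realType} (E F : normedModType R) (f : E -> F)
    (L : {linear E -> F}) x : continuous L ->
  (forall e : R, 0 < e ->
    \forall h \near (0 : E), `|f (h + x) - (f x + L h)| <= e * `|h|) ->
  differentiable f x /\ forall v, 'D_v f x = L v.
Proof.
move=> Lc fL.
have fE : f \o shift x = cst (f x) + L +o_ 0 id.
  by apply/eqaddoP => e e0; have := fL e e0; apply: filterS => h;
    rewrite /= !fctE.
have df := diff_unique Lc fE.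
have fd : differentiable f x by apply/diff_locallyP; rewrite df.
by split => // v; rewrite deriveE// df.
Qed.

Section hadamard.
Context {R : realType} {n : nat}.
Implicit Types (F : 'rV[R]_n -> R) (a y h : 'rV[R]_n).

Definition partial (i : 'I_n) F : 'rV[R]_n -> R := 'D_(delta_mx 0 i) F.

Lemma derive_partial F y v : differentiable F y ->
  'D_v F y = \sum_i v 0 i * partial i F y.
Proof.
move=> dF; rewrite deriveE// [v in LHS]row_sum_delta linear_sum.
by apply: eq_bigr => i _; rewrite linearZ/= /partial deriveE.
Qed.

Lemma smooth_on_partial (V : set 'rV[R]_n) F i :
  smooth_on V F -> smooth_on V (partial i F).
Proof. by move=> Fs k; have [_] := Fs k.+1; apply. Qed.

Lemma smooth_on_diff (V : set 'rV[R]_n) F y :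
  smooth_on V F -> V y -> differentiable F y.
Proof. by move=> Fs Vy; have [+ _] := Fs 1%N; apply. Qed.

Lemma smooth_continuous F : smooth_on setT F -> continuous F.
Proof. by move=> Fs y; exact: (Fs 0%N). Qed.

Lemma is_derive_line F a w (s : R) : (forall y, differentiable F y) ->
  is_derive s (1 : R) (fun s : R => F (a + s *: w))
    (\sum_i w 0 i * partial i F (a + s *: w)).
Proof.
move=> dF.
pose l (s : R) : 'rV[R]_n := a + s *: w.
have lE : l = cst a + ( *:%R^~ w) by [].
have dl : is_diff s l (0 + *:%R^~ w).
  by rewrite lE; apply: is_diffD.
have dl' : differentiable l s by have [] := dl.
have dFl : differentiable (F \o l) s by apply: differentiable_comp.
have -> : (fun s : R => F (a + s *: w)) = F \o l by [].
apply: DeriveDef; first by apply/derivable1_diffP.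
rewrite deriveE// (diff_comp dl' (dF _)) /=.
rewrite -derive_partial// deriveE//; congr ('d F _ _).
by rewrite (diff_val (is_diff_def := dl)) fctE/= add0r scale1r.
Qed.

Lemma continuous_line F a w : continuous F ->
  continuous (fun t : R => F (a + t *: w)).
Proof.
move=> Fc t; apply: (@continuous_comp _ _ _ (fun t : R => a + t *: w) F);
  last exact: Fc.
by apply: continuousD; [exact: cvg_cst|exact: scalel_continuous].
Qed.

(** The radius must not depend on [t].  The point [z] ranges over a
  neighbourhood
    of the segment rather than over the segment, because the mean value theorem
    is applied below on segments that leave it. *)
Lemma segment_unif F a w (e : R) : continuous F -> 0 < e ->
  exists2 d : R, 0 < d & forall t z, 0 <= t <= 1 ->
    `|z - (a + t *: w)| < d -> `|F z - F (a + t *: w)| <= e.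
Proof.
move=> Fc e0.
pose P (d : R) (t : R) := forall z, `|z - (a + t *: w)| < d ->
  `|F z - F (a + t *: w)| <= e.
have /compact_near_coveringP cov := @segment_compact R 0 1.
suff : \forall d \near (0 : R)^'+, `[0%R, 1%R]%classic `<=` P d.
  move=> H; have [d d0 Pd] : exists2 d : R, 0 < d & `[0%R,
    1%R]%classic `<=` P d.
    near (0 : R)^'+ => d; exists d; first by near: d; exact: nbhs_right_gt.
    by near: d; exact: H.
  exists d => // t z t01; apply: Pd.
  by rewrite /= in_itv.
apply: cov => t0 _.
have e20 : 0 < e / 2 by rewrite divr_gt0.
have [d /= d0 dF] : exists2 d : R, 0 < d & forall z, `|z - (a + t0 *: w)| < d ->
    `|F z - F (a + t0 *: w)| <= e / 2.
  have /cvgrPdist_le/(_ _ e20)/nbhs_ballP[d /= d0 dF] := Fc (a + t0 *: w).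
  exists d => // z zd; rewrite distrC; apply: dF.
  by rewrite -ball_normE /ball_/= distrC.
have d20 : 0 < d / 2 by rewrite divr_gt0.
have lc : {for t0, continuous (fun t : R => a + t *: w)}.
  by apply: continuousD; [exact: cvg_cst|exact: scalel_continuous].
have H1 : \forall t \near t0, `|(a + t0 *: w) - (a + t *: w)| < d / 2.
  by move/cvgrPdist_lt : lc => /(_ _ d20).
have H2 : \forall d' \near (0 : R)^'+, d' < d / 2 by exact: nbhs_right_lt.
exists ([set t | `|(a + t0 *: w) - (a + t *: w)| < d / 2],
  [set d' | d' < d / 2]) => //.
move=> [t d'] /= [tt0 d'd] z zt.
rewrite -(subrKA (F (a + t0 *: w))) (splitr e).
apply: le_trans (ler_normD _ _) _; apply: lerD.
  apply: dF; rewrite -(subrKA (a + t *: w)) (splitr d).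
  apply: le_lt_trans (ler_normD _ _) _; apply: ltrD; first exact: lt_trans zt _.
  by rewrite distrC.
rewrite distrC; apply: dF; rewrite distrC; apply: lt_trans tt0 _.
by rewrite [ltRHS]splitr ltrDl.
Unshelve. all: by end_near. Qed.


(** The weights [t ^+ j] make this family stable under differentiation. *)
Definition ray_int a (j : nat) F y : R :=
  unit_int (fun t => t ^+ j * F (a + t *: (y - a))).

Lemma continuous_ray a j F w : continuous F ->
  continuous (fun t : R => t ^+ j * F (a + t *: w)).
Proof.
move=> Fc; apply: continuous_mulf; last exact: continuous_line.
exact: exprn_continuous.
Qed.

Lemma weight_norm (t : R) j (x : R) : 0 <= t <= 1 -> `|t ^+ j * x| <= `|x|.
Proof.
move=> /andP[t0 t1]; rewrite normrM normrX (ger0_norm t0).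
by rewrite ler_piMl// exprn_ile1.
Qed.

Lemma ray_int_continuous a j F : continuous F -> continuous (ray_int a j F).
Proof.
move=> Fc y; apply/(@cvgrPdist_le _ _ _ (nbhs y) (nbhs_filter y)) => e e0.
have [d d0 dF] := segment_unif a (y - a) Fc e0.
near=> z; rewrite /ray_int -unit_intB; try exact: continuous_ray.
apply: unit_int_bound => [|t t01].
  by apply: continuous_subf; exact: continuous_ray.
rewrite -mulrBr; apply: le_trans (weight_norm _ _ t01) _.
rewrite distrC; apply: dF => //.
rewrite opprD addrACA subrr add0r -scalerBr opprB addrA subrK normrZ.
have /andP[t0 t1] := t01; rewrite (ger0_norm t0).
have zy : `|y - z| < d.
  by near: z; apply/nbhs_ballP; exists d => // z; rewrite -ball_normE.
by apply: le_lt_trans (ler_piMl _ t1) _; rewrite // distrC.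
Unshelve. all: by end_near. Qed.

Definition ray_diff a j F y h : R :=
  \sum_i h 0 i * ray_int a j.+1 (partial i F) y.

Lemma ray_diff_linear a j F y : linear (ray_diff a j F y).
Proof.
move=> c u v; rewrite /ray_diff scaler_sumr -big_split/=; apply: eq_bigr => i _.
by rewrite !mxE mulrDl -mulrA.
Qed.
HB.instance Definition _ a j F y := GRing.isLinear.Build R 'rV[R]_n R *:%R
  (ray_diff a j F y) (ray_diff_linear a j F y).

Lemma ray_diff_continuous a j F y : continuous (ray_diff a j F y).
Proof.
move=> h; apply: (@Ck_sum _ 0 _ _ setT _ (index_enum 'I_n) xpredT
  (fun i h => h 0 i * ray_int a j.+1 (partial i F) y)) => //;
    first exact: openT.
move=> i _; apply: Ck_mulf; [exact: openT|exact: Ck_mx_coord|exact: Ck_cst].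
Qed.

(** Differentiation under the integral sign: by the mean value theorem on the
    segment from [p = a + t *: (y - a)] to [p + t *: h], the error of the linear
    approximation is controlled by the oscillation of the partial derivatives
    along the segment from [a] to [y]. *)
Lemma ray_int_diff a j F y : smooth_on setT F ->
  differentiable (ray_int a j F) y /\
  forall v, 'D_v (ray_int a j F) y = ray_diff a j F y v.
Proof.
move=> Fs; have Fc := smooth_continuous Fs.
have Fd z : differentiable F z by exact: smooth_on_diff Fs I.
have pc i : continuous (partial i F) by
  apply/smooth_continuous/smooth_on_partial.
apply: linear_approx_diff => [|e e0]; first exact: ray_diff_continuous.
  have e'0 : 0 < e / (n%:R + 1) by rewrite divr_gt0// ltr_wpDl.
  pose Q (i : 'I_n) (d : R) := 0 < d /\ forall t z, 0 <= t <= 1 ->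
    `|z - (a + t *: (y - a))| < d ->
    `|partial i F z - partial i F (a + t *: (y - a))| <= e / (n%:R + 1).
  have /choice[d dP] : forall i, exists d, Q i d.
    by move=> i; have [d d0 H] := segment_unif a (y - a) (pc i) e'0; exists d.
  have H : \forall h \near (0 : 'rV[R]_n), forall i, `|h| < d i.
    apply: (filter_forall (nbhs_filter (0 : 'rV[R]_n))) => i.
    have [di0 _] := dP i; apply/nbhs_ballP; exists (d i) => // z.
    by rewrite -ball_normE /= sub0r normrN.
  apply: filterS H => h hd.
  rewrite opprD addrA /ray_int.
  rewrite -unit_intB; try exact: continuous_ray.
  have dE : ray_diff a j F y h =
    unit_int (fun t => \sum_i h 0 i * (t ^+ j.+1 * partial i F (a + t *:
      (y - a)))).
    rewrite /ray_diff /ray_int.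
    rewrite unit_int_sum.
      by apply: eq_bigr => i _; rewrite unit_intZ//; exact: continuous_ray.
    by move=> i; apply: continuous_mulf; [exact: continuous_cstf|exact:
      continuous_ray].
  have sc : continuous (fun t : R => \sum_i h 0 i * (t ^+ j.+1 * partial i F (a
    + t *: (y - a)))).
    apply: continuous_sumr => i.
    by apply: continuous_mulf; [exact: continuous_cstf|exact: continuous_ray].
  have bc : continuous (fun t : R => t ^+ j * F (a + t *: (h + y - a)) -
      t ^+ j * F (a + t *: (y - a))).
    by apply: continuous_subf; exact: continuous_ray.
  rewrite -[GRing.Linear.sort _ h]/(ray_diff a j F y h) dE -unit_intB//;
    apply: unit_int_bound => [|t t01]; first exact: continuous_subf.
  have /andP[t0 t1] := t01.
  set p := a + t *: (y - a).
  have -> : a + t *: (h + y - a) = p + 1 *: (t *: h).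
    by rewrite -[h + y - a]addrA [h + _]addrC scalerDr addrA /p scale1r.
  have [c c01] := MVT_segment (ler01 : 0 <= 1 :> R)
    (fun s _ => is_derive_line p (t *: h) s Fd)
    (continuous_subspaceT (continuous_line (a := p) (w := t *: h) Fc)).
  rewrite subr0 mulr1 scale0r addr0 => MV.
  rewrite -mulrBr MV mulr_sumr -sumrB.
  have -> : \sum_(i < n) (t ^+ j * ((t *: h) 0 i * partial i F (p + c *: (t *:
    h))) -
      h 0 i * (t ^+ j.+1 * partial i F p)) =
    \sum_(i < n) t ^+ j.+1 * (h 0 i * (partial i F (p + c *: (t *:
      h)) - partial i F p)).
    by apply: eq_bigr => i _; rewrite !mxE exprS; ring.
  apply: le_trans (ler_norm_sum _ _ _) _.
  apply: (@le_trans _ _ (\sum_(i < n) `|h| * (e / (n%:R + 1)))).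
    apply: ler_sum => i _; apply: le_trans (weight_norm _ _ t01) _.
    rewrite normrM; apply: ler_pM => //; first exact: rV_norm_coord.
    have [di0 di] := dP i; apply: di => //.
    rewrite addrAC subrr add0r !normrZ mulrA.
    apply: le_lt_trans (hd i); rewrite ler_piMl// -normrM.
    move: c01; rewrite in_itv/= => /andP[c0 c1].
    by rewrite ger0_norm ?mulr_ge0// mulr_ile1.
  rewrite sumr_const card_ord -(mulr_natr (`|h| * _)) -mulrA mulrC ler_wpM2r//.
  have n10 : 0 < n%:R + 1 :> R by rewrite ltr_wpDl.
  have nn1 : n%:R <= n%:R + 1 :> R by rewrite lerDl.
  by rewrite mulrAC ler_pdivrMr// ler_wpM2l// ltW.
Qed.

Lemma Ck_ray_int k a j F : smooth_on setT F -> Ck k setT (ray_int a j F).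
Proof.
elim: k j F => [|k IH] j F Fs.
  by move=> x _; apply: ray_int_continuous; exact: smooth_continuous.
split=> [y _|v]; first by have [] := ray_int_diff a j y Fs.
have -> : 'D_v (ray_int a j F) =
    fun y => \sum_i v 0 i * ray_int a j.+1 (partial i F) y.
  by apply/funext => y; have [_ ->] := ray_int_diff a j y Fs.
apply: Ck_sum => [|i _]; first exact: openT.
apply: Ck_mulf; [exact: openT|exact: Ck_cst|].
exact/IH/smooth_on_partial.
Qed.

(** Hadamard's lemma, by integrating the derivative of [F] along the segment
    from [a] to [y]. *)
Lemma hadamard F a : smooth_on setT F -> exists2 G : 'I_n -> 'rV[R]_n -> R,
  forall i, smooth_on setT (G i) &
  forall y, F y = F a + \sum_i (y 0 i - a 0 i) * G i y.
Proof.
move=> Fs; exists (fun i => ray_int a 0 (partial i F)).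
  by move=> i k; apply/Ck_ray_int/smooth_on_partial.
move=> y.
have pc i : continuous (partial i F) by
  apply/smooth_continuous/smooth_on_partial.
have ic i : continuous (fun t : R => (y - a) 0 i * partial i F (a + t *:
  (y - a))).
  by apply: continuous_mulf; [exact: continuous_cstf|exact: continuous_line].
have := unit_int_FTC (fun t => is_derive_line a (y - a) t
  (fun z => smooth_on_diff Fs (I : setT z))) (continuous_sumr ic).
rewrite scale1r subrKC scale0r addr0 unit_int_sum// => H.
rewrite -[LHS](subrK (F a)) -H addrC; congr (_ + _); apply: eq_bigr => i _.
rewrite unit_intZ; last exact: continuous_line.
rewrite !mxE /ray_int; congr (_ * unit_int _); apply/funext => t.
by rewrite expr0 mul1r.
Qed.

End hadamard.

(** * Admissible charts *)

Lemma filter_finI_from (T Y : Type) (I : choiceType) (D : set I) (b : I ->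
  set Y)
    (F : set_system T) (FF : Filter F) (f : T -> Y) (C : set Y) :
  finI_from D b C -> (forall i, D i -> C `<=` b i -> F (f @^-1` b i)) ->
  F (f @^-1` C).
Proof.
move=> [A AD <-] H; rewrite preimage_bigcap; apply: filter_bigI => i iA.
apply: H; first by have /set_mem := AD i iA.
by apply: bigcap_inf.
Qed.

Section atlas_topology.
Context {R : realType} {E : normedModType R} (X : atlas_space E).

Lemma atlas_open (c : chart X E) (O : set E) : atlas c -> open O ->
  open (cdom c `&` cmap c @^-1` O).
Proof.
move=> Ac oO; set W := _ `&` _.
exists [set W]; last by rewrite bigcup_set1.
move=> _ ->.
pose D := [set W | exists c : chart X E, exists O : set E,
  [/\ atlas c, open O & W = cdom c `&` cmap c @^-1` O]].
suff DW : D W by exact: (@finI_from1 _ _ D id W DW).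
by exists c, O.
Qed.

(** The charts generate the topology, so a neighbourhood of [f t] contains a
    finite intersection of chart sets, which can be treated one by one. *)
Lemma atlas_cvg (T : topologicalType) (f : T -> X) (t : T) :
  (forall (c : chart X E) O, atlas c -> open O -> cdom c (f t) ->
    O (cmap c (f t)) ->
    \forall s \near t, cdom c (f s) /\ O (cmap c (f s))) ->
  {for t, continuous f}.
Proof.
move=> H A; rewrite nbhsE => -[B [[D' D'sub <-] [C D'C Cft]] BA].
have : \forall s \near t, C (f s).
  apply: (@filter_finI_from _ _ _ _ _ (nbhs t) _ f C (D'sub _ D'C)).
  move=> i [c [V [Ac oV iE]]] Ci.
  have := Ci _ Cft; rewrite /= iE => -[ct Ot]; exact: H.
by apply: filterS => s Cfs; apply: BA; exists C.
Qed.

End atlas_topology.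

Section charts.
Context {R : realType} {n : nat} (M : manifold R n).
Implicit Types (c d : chart M 'rV[R]_n) (f : Cinf M) (u x : M) (U W : set M).

Lemma atlas_cover u : exists2 c : chart M 'rV[R]_n, atlas c & cdom c u.
Proof. by have [_ _ _ H _] := manifoldP M. Qed.

Lemma atlas_admissible c : atlas c -> admissible_chart c.
Proof.
have [_ _ _ _ H] := manifoldP M => Ac.
have [ic cc] := H c Ac; split => //; first exact: open_chart.
by move=> d Ad; split; [exact: cc|have [_] := H d Ad; exact].
Qed.

(** Admissible charts are used throughout in place of those of the atlas,
    because the coordinate systems on spaces of A-points are built on them. *)
Lemma admissible_open_dom c O : admissible_chart c -> open O ->
  open (cdom c `&` cmap c @^-1` O).
Proof.
move=> [ic _ cc] oO; rewrite openE => x [cx Ox].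
have [d Ad dx] := atlas_cover x.
have [_ [oS [g gs gE]]] := cc d Ad.
have [id_ _ _] := atlas_admissible Ad.
have oSg : open ((cmap d @` (cdom d `&` cdom c)) `&` g @^-1` O).
  by apply: open_preimage => //; exact: (gs 0%N).
have oW := atlas_open Ad oSg.
have nW : nbhs x (cdom d `&` cmap d @^-1` ((cmap d @` (cdom d `&` cdom c)) `&`
  g @^-1` O)).
  apply: open_nbhs_nbhs; split => //; split=> //; split; first by exists x.
  by rewrite /= -gE.
apply: filterS nW.
move=> y [dy [[z [dz cz] zy] Ogy]].
have yz : z = y by apply: id_ => //; exact: mem_set.
by subst z; split => //; rewrite /= gE.
Qed.

Lemma admissible_dom_open c : admissible_chart c -> open (cdom c).
Proof.
move=> Ac; rewrite -(setIT (cdom c)) -(preimage_setT (cmap c)).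
exact: (admissible_open_dom Ac openT).
Qed.

Definition base_pt : M := projT1 (cid (let: And5 h _ _ _ _ := manifoldP M in
  h)).

Definition chart_inv c (y : 'rV[R]_n) : M :=
  xget base_pt [set x | cdom c x /\ cmap c x = y].

Lemma chart_invP c y : (cmap c @` cdom c) y ->
  cdom c (chart_inv c y) /\ cmap c (chart_inv c y) = y.
Proof.
move=> [x cx xy]; have := @xgetPex _ base_pt [set x | cdom c x /\ cmap c x = y].
by apply; exists x.
Qed.

Lemma chart_invK c x : admissible_chart c -> cdom c x ->
  chart_inv c (cmap c x) = x.
Proof.
move=> [ic _ _] cx; have [cx' e] : cdom c (chart_inv c (cmap c x)) /\
    cmap c (chart_inv c (cmap c x)) = cmap c x by apply: chart_invP; exists x.
by apply: ic => //; exact: mem_set.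
Qed.

Lemma chart_inv_continuous c y : admissible_chart c -> (cmap c @` cdom c) y ->
  {for y, continuous (chart_inv c)}.
Proof.
move=> Ac cy; apply: atlas_cvg => d O Ad oO dcy Ocy.
have [ic _ cc] := Ac; have [[oS [g gs gE]] _] := cc d Ad.
have [cx xy] := chart_invP cy.
have Sy : (cmap c @` (cdom c `&` cdom d)) y by exists (chart_inv c y).
have oSg : open ((cmap c @` (cdom c `&` cdom d)) `&` g @^-1` O).
  by apply: open_preimage => //; exact: (gs 0%N).
have nS : nbhs y ((cmap c @` (cdom c `&` cdom d)) `&` g @^-1` O).
  by apply: open_nbhs_nbhs; split => //; split => //; rewrite /= -xy -gE.
apply: filterS nS => z [[x' [cx' dx'] <-] Og].
by rewrite chart_invK//; split => //; rewrite gE.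
Qed.

Lemma chart_image_open c W : admissible_chart c -> open W ->
  open (cmap c @` (cdom c `&` W)).
Proof.
move=> Ac oW; have [_ oc _] := Ac.
rewrite openE => _ [x [cx Wx] <-].
have cy : (cmap c @` cdom c) (cmap c x) by exists x.
have H1 : nbhs (cmap c x) (cmap c @` cdom c) by apply: open_nbhs_nbhs.
have H2 : nbhs (cmap c x) (chart_inv c @^-1` W).
  apply: (chart_inv_continuous Ac cy); apply: open_nbhs_nbhs.
  by rewrite chart_invK.
apply: filterS2 H1 H2 => y /chart_invP[cz zy] Wz.
by exists (chart_inv c y).
Qed.

Definition chart_rep c (f : M -> R) (y : 'rV[R]_n) : R := f (chart_inv c y).

Lemma chart_repE c (f : M -> R) x : admissible_chart c -> cdom c x ->
  chart_rep c f (cmap c x) = f x.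
Proof. by move=> Ac cx; rewrite /chart_rep chart_invK. Qed.

Lemma Cinf_smooth f : smooth_fun setT (f : M -> R).
Proof. by case: f => f /= /asboolP. Qed.

Lemma chart_rep_smooth c f k : admissible_chart c ->
  Ck k (cmap c @` cdom c) (chart_rep c f).
Proof.
move=> Ac; have [ic oc cc] := Ac.
apply: Ck_local => _ [x cx <-].
have [d Ad dx] := atlas_cover x.
have Adad := atlas_admissible Ad.
have [[oS [g gs gE]] _] := cc d Ad.
exists (cmap c @` (cdom c `&` cdom d)).
  by split => //; exists x.
have [h hs hE] := Cinf_smooth f Ad.
rewrite setIT in hs hE.
have oD := open_chart Ad.
have gS y : (cmap c @` (cdom c `&` cdom d)) y -> (cmap d @` cdom d) (g y).
  by move=> [z [cz dz] <-]; rewrite -gE//; exists z.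
apply: Ck_eq (Ck_comp oS oD gS (gs k) (hs k)) => // _ [z [cz dz] <-].
by rewrite /= chart_repE// -gE// -hE.
Qed.

(** Smoothness has to be checked in the charts of the atlas; the transition from
    such a chart to the chart [c] given near a point is smooth because [c] is
    admissible. *)
Lemma Cinf_glue (f : M -> R) :
  (forall x, exists c F W, [/\ admissible_chart c, open W /\ W x, W `<=` cdom c,
     smooth_on (cmap c @` W) F & forall z, W z -> f z = F (cmap c z)]) ->
  exists h : Cinf M, h = f :> (M -> R).
Proof.
move=> H.
suff fs : f \in @Cinf_pred R n M by exists (MkCinf fs).
apply/asboolP => d Ad; rewrite setIT.
have Adad := atlas_admissible Ad.
exists (chart_rep d f); last by move=> x dx; rewrite chart_repE.
move=> k; apply: Ck_local => _ [x dx <-].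
have [c [F [W [Ac [oW Wx] Wc FC FE]]]] := H x.
have [_ _ /(_ d Ad)[_ [oS [g gs gE]]]] := Ac.
have oV := chart_image_open Adad oW.
exists (cmap d @` (cdom d `&` W)); first by split => //; exists x.
have oW' : open (cmap c @` W).
  by have := chart_image_open Ac oW; rewrite (_ : cdom c `&` W = W)//;
    apply/setIidr.
have gS y : (cmap d @` (cdom d `&` W)) y -> (cmap c @` W) (g y).
  by move=> [z [dz Wz] <-]; rewrite -gE//; [exists z|split => //; exact: Wc].
have gk : Ck k (cmap d @` (cdom d `&` W)) g.
  apply: Ck_sub (gs k) => _ [z [dz Wz] <-]; exists z => //; split => //;
    exact: Wc.
apply: Ck_eq (Ck_comp oV oW' gS gk (FC k)) => // _ [z [dz Wz] <-].
by rewrite /= chart_repE// -gE ?FE//; split => //; exact: Wc.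
Qed.

End charts.

(** * Extension by zero and coordinates given by global functions *)

Section cutoffs.
Context {R : realType} {n : nat} (M : manifold R n).
Implicit Types (c d : chart M 'rV[R]_n) (f : Cinf M) (u x : M) (U W : set M).

Lemma CinfD f (g : Cinf M) x : (f + g) x = f x + g x. Proof. by []. Qed.
Lemma CinfB f (g : Cinf M) x : (f - g) x = f x - g x. Proof. by []. Qed.
Lemma CinfM f (g : Cinf M) x : (f * g) x = f x * g x. Proof. by []. Qed.
Lemma CinfZ (a : R) f x : (a *: f) x = a * f x. Proof. by []. Qed.
Lemma Cinf1 x : (1 : Cinf M) x = 1. Proof. by []. Qed.
Lemma Cinf0 x : (0 : Cinf M) x = 0. Proof. by []. Qed.
Lemma Cinf_sum (I : Type) (r : seq I) (P : pred I) (g : I -> Cinf M) x :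
  (\sum_(i <- r | P i) g i) x = \sum_(i <- r | P i) g i x.
Proof. by elim/big_rec2 : _ => // i y1 y2 _ <-. Qed.
Lemma Cinf_prod (I : Type) (r : seq I) (P : pred I) (g : I -> Cinf M) x :
  (\prod_(i <- r | P i) g i) x = \prod_(i <- r | P i) g i x.
Proof. by elim/big_rec2 : _ => // i y1 y2 _ <-. Qed.
Lemma Cinf_ext f (g : Cinf M) : (forall x, f x = g x) -> f = g.
Proof. by move=> fg; apply: val_inj; apply/funext. Qed.

Lemma closed_norm_ball (a : 'rV[R]_n) (r : R) : closed [set y | `|y - a| <= r].
Proof.
apply: (@closed_comp _ _ (fun y : 'rV[R]_n => `|y - a|) [set t | t <= r]).
  have sc : Ck 0 setT (fun y : 'rV[R]_n => y - a).
    by apply: Ck_addf; [exact: openT|exact: Ck_id|exact: Ck_cst].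
  by move=> y _; exact: cvg_norm (sc y I).
exact: closed_le.
Qed.

Lemma compact_norm_ball (a : 'rV[R]_n) (r : R) :
  compact [set y | `|y - a| <= r].
Proof.
apply: bounded_closed_compact; last exact: closed_norm_ball.
exists (`|a| + r); split; first exact: num_real.
move=> m mr y /= ya.
rewrite -(subrK a y); apply: le_trans (ler_normD _ _) _.
by apply: le_trans (ltW mr); rewrite addrC lerD2l.
Qed.

Lemma nbhs_norm_radius (V : set 'rV[R]_n) (a : 'rV[R]_n) : nbhs a V ->
  exists2 r : R, 0 < r & forall y, `|y - a| <= r -> V y.
Proof.
move=> /nbhs_ballP[e /= e0 eV]; exists (e / 2); first exact: divr_gt0.
move=> y ya; apply: eV; rewrite -ball_normE /= distrC.
by apply: le_lt_trans ya _; rewrite [ltRHS]splitr ltrDl divr_gt0.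
Qed.

(** Smooth functions on a chart, cut off near a point, extend by zero.  This
    uses that a compact subset of the chart is closed in the manifold, hence
    that the manifold is Hausdorff. *)
Lemma cutoff_ext c u (O : set 'rV[R]_n) : admissible_chart c -> cdom c u ->
  open O -> O (cmap c u) ->
  exists W, [/\ open W, W u, W `<=` cdom c `&` cmap c @^-1` O
  & forall F, smooth_on (cmap c @` cdom c) F ->
    exists h : Cinf M, (forall x, W x -> h x = F (cmap c x)) /\
      (forall x, ~ (cdom c x /\ O (cmap c x)) -> h x = 0)].
Proof.
move=> Ac cu oO Ou; have [ic oc cc] := Ac; set a := cmap c u.
have [e e0 eV] : exists2 e : R, 0 < e & forall y, `|y - a| <= e ->
    ((cmap c @` cdom c) `&` O) y.
  apply: nbhs_norm_radius; apply: open_nbhs_nbhs; split; first exact: openI.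
  by split => //; exists u.
(* [box_bump a r] vanishes from distance [2 * r = e] on. *)
pose r := e / 2; have r0 : 0 < r by rewrite divr_gt0.
have e2r : e = 2 * r by rewrite /r mulrC divfK.
pose K := chart_inv c @` [set y | `|y - a| <= e].
have cK : closed K.
  apply: compact_closed; first by have [] := manifoldP M.
  apply: (@continuous_compact 'rV[R]_n M (chart_inv c) [set y | `|y - a| <= e]);
    last exact: compact_norm_ball.
  apply: continuous_in_subspaceT => y /set_mem /eV [Vy _].
  exact: chart_inv_continuous.
have KE x : cdom c x -> ~ K x -> e < `|cmap c x - a|.
  move=> cx Kx; rewrite ltNge; apply/negP => xe; apply: Kx.
  by exists (cmap c x) => //; rewrite chart_invK.
have Kc : K `<=` cdom c.
  by move=> _ [y /eV[Vy _] <-]; have [] := chart_invP Vy.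
exists (cdom c `&` cmap c @^-1` [set y | `|y - a| < r]); split.
- apply: admissible_open_dom => //.
  rewrite (_ : [set y | _] = ball a r); first exact: ball_open.
  by apply/seteqP; split => y; rewrite -ball_normE /= distrC.
- by split => //=; rewrite subrr normr0.
- move=> x [cx /= xr]; split => //.
  have xe : `|cmap c x - a| <= e.
    by apply: ltW (lt_trans xr _); rewrite e2r ltr_pMl// ltr1n.
  by have [] := eV _ xe.
move=> F FC; pose hf x := if `[< cdom c x >] then box_bump a r (cmap c x) * F
  (cmap c x) else 0.
have [|h hE] := @Cinf_glue _ _ M hf.
  move=> x; have [cx|ncx] := pselect (cdom c x).
    exists c, (fun y => box_bump a r y * F y), (cdom c); split => //.
    - by split => //; exact: admissible_dom_open.
    - move=> k; apply: Ck_mulf => //; apply: Ck_sub (Ck_box_bump k a r) => //.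
    - by move=> z cz; rewrite /hf asboolT.
  have [d Ad dx] := atlas_cover x.
  have Adad := atlas_admissible Ad.
  exists d, (cst 0), (cdom d `&` ~` K); split => //.
  - split; last by split => // /Kc.
    by apply: openI; [exact: admissible_dom_open|exact: closed_openC].
  - by move=> k; exact: Ck_cst.
  - move=> z [dz Kz]; rewrite /hf; case: asboolP => // cz.
    by rewrite box_bump0 ?mul0r// -e2r ltW// KE.
exists h; rewrite hE; split => x.
  by move=> [cx /= /ltW xr]; rewrite /hf asboolT// box_bump1// mul1r.
move=> H; rewrite /hf; case: asboolP => // cx; rewrite box_bump0 ?mul0r//.
rewrite -e2r ltW// ltNge; apply/negP => xe; apply: H; split => //.
by have [] := eV _ xe.
Qed.

(** An A-point evaluates global functions only, so coordinates of A-points come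
    from charts whose coordinates extend to the whole manifold. *)
Definition coord_chart U (x : 'I_n -> Cinf M) : chart M 'rV[R]_n :=
  Chart U (fun u => \row_i (x i u : R)).

(** The coordinates are compared on [U] only: outside [U] the functions [g] and
    [cmap c] may differ, as happens when [g] comes from global functions. *)
Lemma admissible_restrict c U (g : M -> 'rV[R]_n) : admissible_chart c ->
  open U -> U `<=` cdom c -> (forall u, U u -> g u = cmap c u) ->
  admissible_chart (Chart U g).
Proof.
move=> Ac oU Uc gc; have [ic oc cc] := Ac.
have imE S : S `<=` U -> g @` S = cmap c @` S.
  by move=> SU; apply: eq_imagel => z /SU; exact: gc.
split => /=.
- move=> z t /set_mem Uz /set_mem Ut; rewrite !gc// => /ic; apply;
  apply/mem_set; exact: Uc.
- by rewrite imE// -[U in X in open X](setIidr Uc); exact: chart_image_open.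
move=> d Ad; have Adad := atlas_admissible Ad.
have [[w1 s1] [w2 s2]] := cc d Ad.
split; split => /=.
- rewrite imE; last exact: subIsetl.
  rewrite -{1}(setIidr Uc) -setIA; apply: chart_image_open => //.
  by apply: openI => //; exact: admissible_dom_open.
- have [k ks kE] := s1; exists k.
    rewrite imE; last exact: subIsetl.
    by move=> j; apply: Ck_sub (ks j); apply: image_subset; apply: setSI.
  by move=> z [Uz dz]; rewrite /= gc// kE//; split => //; exact: Uc.
- exact: chart_image_open.
- have [k ks kE] := s2; exists k.
    by move=> j; apply: Ck_sub (ks j); apply: image_subset; apply: setIS.
  by move=> z [dz Uz]; rewrite /= gc// kE//; split => //; exact: Uc.
Qed.

Lemma coord_chart_ex u : exists (U : set M) (x : 'I_n ->
  Cinf M), [/\ admissible_chart (coord_chart U x), U u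
  & exists psi : Cinf M, exists2 W, open W /\ W u &
      (forall z, W z -> psi z = 1) /\ (forall z, ~ U z -> psi z = 0)].
Proof.
have [c Ac0 cu] := atlas_cover u; have Ac := atlas_admissible Ac0.
have [W [oW Wu Wc WF]] := cutoff_ext Ac cu openT (I : setT (cmap c u)).
have /choice[x xP] : forall i, exists h : Cinf M,
    (forall z, W z -> h z = cmap c z 0 i).
  move=> i; have [|h [hW _]] := WF (fun y => y 0 i); last by exists h.
  by move=> k; exact: Ck_mx_coord.
have Ac' : admissible_chart (coord_chart W x).
  apply: admissible_restrict Ac oW _ _; first by move=> z /Wc[].
  by move=> z Wz; apply/rowP => i; rewrite mxE xP.
exists W, x; split => //.
have [W' [oW' W'u W'c W'F]] := cutoff_ext Ac' Wu openT (I : setT _).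
have [|psi [psi1 psi0]] := W'F (cst 1); first by move=> k; exact: Ck_cst.
exists psi, W' => //; split => z; first exact: psi1.
by move=> nW; apply: psi0 => -[].
Qed.

End cutoffs.

(** * Weil algebras *)

Section weil_algebra_theory.
Context {R : realType} {A : falgType R} (hA : weil_algebra A).
Implicit Types a b : A.
Local Notation nonunit a := (a \isn't a GRing.unit).

Lemma weilC a b : a * b = b * a. Proof. by have [H _ _] := hA. Qed.

Lemma nonunit0 : nonunit (0 : A). Proof. by rewrite unitr0. Qed.

Lemma nonunitD a b : nonunit a -> nonunit b -> nonunit (a + b).
Proof. by have [_ H _] := hA; exact: H. Qed.

Lemma nonunitMr a b : nonunit a -> nonunit (a * b).
Proof.
by move=> na; rewrite unitrM_comm; [rewrite negb_and na|exact: weilC].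
Qed.

Lemma nonunitMl a b : nonunit b -> nonunit (a * b).
Proof. by rewrite weilC; exact: nonunitMr. Qed.

Lemma nonunitN a : nonunit a -> nonunit (- a).
Proof. by rewrite -mulN1r; exact: nonunitMl. Qed.

Lemma nonunitZ (c : R) a : nonunit a -> nonunit (c *: a).
Proof. by move=> na; rewrite -[a]mul1r scalerAl; exact: nonunitMl. Qed.

Lemma nonunit_sum I (r : seq I) (P : pred I) (F : I -> A) :
  (forall i, P i -> nonunit (F i)) -> nonunit (\sum_(i <- r | P i) F i).
Proof.
move=> H; apply: (big_ind (fun a => nonunit a)) => //; first exact: nonunit0.
exact: nonunitD.
Qed.

Lemma scalar_unit (c : R) : c != 0 -> c%:A \is a @GRing.unit A.
Proof.
move=> c0; apply/unitrP; exists (c^-1%:A).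
by rewrite -!scalerAl !mul1r !scalerA mulVf// mulfV// scale1r.
Qed.

(** The augmentation: the class of [a] modulo the maximal ideal. *)
Definition aug a : R := projT1 (cid (let: And3 _ _ H := hA in H a)).

Lemma augP a : nonunit (a - (aug a)%:A).
Proof. exact: (projT2 (cid (let: And3 _ _ H := hA in H a))). Qed.

Lemma aug_unique a (c : R) : nonunit (a - c%:A) -> aug a = c.
Proof.
move=> na; have := nonunitD na (nonunitN (augP a)).
rewrite opprB addrC addrA subrK -scalerBl.
by apply: contraNeq; rewrite -subr_eq0; exact: scalar_unit.
Qed.

Lemma aug_eq0 a : (aug a == 0) = (a \isn't a GRing.unit).
Proof.
apply/eqP/idP => [a0|na]; first by have := augP a; rewrite a0 scale0r subr0.
by apply: aug_unique; rewrite scale0r subr0.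
Qed.

Lemma augD a b : aug (a + b) = aug a + aug b.
Proof.
apply: aug_unique; rewrite scalerDl opprD addrACA.
by apply: nonunitD; exact: augP.
Qed.

Lemma augZ (c : R) a : aug (c *: a) = c * aug a.
Proof. by apply: aug_unique; rewrite -scalerA -scalerBr;
  exact/nonunitZ/augP. Qed.

Lemma aug_scalar (c : R) : aug c%:A = c.
Proof. by apply: aug_unique; rewrite subrr; exact: nonunit0. Qed.

Lemma aug_is_linear : linear aug.
Proof. by move=> c a b; rewrite augD augZ. Qed.
HB.instance Definition _ := GRing.isLinear.Build R A R *:%R aug aug_is_linear.

(** Multiplying a nonzero element [w] by a nonunit strictly shrinks the ideal
    that it generates, so a product of [\dim A] nonunits vanishes.  This is the
    only form in which nilpotency of the maximal ideal is used. *)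
Lemma prod_nonunits (s : seq A) : all (fun a => nonunit a) s ->
  (\dim {:A} <= size s)%N -> \prod_(a <- s) a = 0.
Proof.
move=> sn; apply: contraTeq; rewrite -ltnNge.
suff H : \prod_(a <- s) a != 0 ->
    (size s + \dim ({:A} * <[\prod_(a <- s) a]>) <= \dim {:A})%N.
  move=> w0; apply: leq_trans (H w0); rewrite -addn1 leq_add2l lt0n.
  rewrite dimv_eq0 -subv0; apply: contra w0 => /subvP/(_ (\prod_(a <- s) a)).
  rewrite memv0; apply; apply/memv_cosetP.
  by exists 1; [exact: memvf|rewrite mul1r].
elim: s sn => [_ _|a s IH /= /andP[na sn]]; first by rewrite add0n dimvS//
  subvf.
rewrite big_cons; set w := \prod_(b <- s) b => w'0.
have w0 : w != 0 by apply: contraNneq w'0 => ->; rewrite mulr0.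
apply: leq_trans (IH sn w0); rewrite addSn -addnS leq_add2l ltnNge.
have sub : ({:A} * <[a * w]> <= {:A} * <[w]>)%VS.
  apply/subvP => v /memv_cosetP[x _ ->]; apply/memv_cosetP.
  by exists (x * a); [exact: memvf|rewrite mulrA].
apply/negP => le; have /eqP e : ({:A} * <[a * w]> == {:A} * <[w]>)%VS.
  by rewrite eqEdim sub le.
have : w \in ({:A} * <[a * w]>)%VS.
  by rewrite e; apply/memv_cosetP; exists 1; [exact: memvf|rewrite mul1r].
move=> /memv_cosetP[x _ wE].
have xw : (1 - x * a) * w = 0 by rewrite mulrBl mul1r -mulrA -wE subrr.
have un : 1 - x * a \is a GRing.unit.
  apply/negPn/negP => nu; have := nonunitD nu (nonunitMl x na).
  by rewrite subrK unitr1.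
by move: w0; rewrite -[w](mulKr un) xw mulr0 eqxx.
Qed.

End weil_algebra_theory.

(** * A-points lie near points and are determined by coordinates *)

Section smooth_function_constructions.
Context {R : realType} {n : nat} (M : manifold R n).
Implicit Types (c d : chart M 'rV[R]_n) (f g : Cinf M) (u : M) (U W : set M).

Lemma Cinf_local (h : M -> R) :
  (forall u, exists f, exists2 W, open W /\ W u & forall z, W z -> h z = f z) ->
  exists f, f = h :> (M -> R).
Proof.
move=> H; apply: Cinf_glue => u; have [f [W [oW Wu] hf]] := H u.
have [c Ac0 cu] := atlas_cover u; have Ac := atlas_admissible Ac0.
exists c, (chart_rep c f), (cdom c `&` W); split => //.
- by split => //; apply: openI => //; exact: admissible_dom_open.
- move=> k; apply: Ck_sub (chart_rep_smooth f k Ac).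
  by apply: image_subset.
- by move=> z [cz Wz]; rewrite chart_repE// hf.
Qed.

Lemma Cinf_inverse f : (forall u, f u != 0) -> exists g, f * g = 1.
Proof.
move=> f0; have [|g gE] := @Cinf_glue _ _ M (fun u => (f u)^-1).
  move=> u; have [c Ac0 cu] := atlas_cover u; have Ac := atlas_admissible Ac0.
  exists c, (fun y => (chart_rep c f y)^-1), (cdom c); split => //.
  - by split => //; exact: admissible_dom_open.
  - move=> k; apply: CkV; first exact: open_chart.
      by move=> y _; exact: f0.
    exact: chart_rep_smooth.
  - by move=> z cz; rewrite chart_repE.
by exists g; apply: Cinf_ext => u; rewrite CinfM gE mulfV.
Qed.

(** Before Hadamard's lemma applies, [f] read in the chart is cut off to a
    function on the whole vector space; its coefficients are then cut off to
    extend to the manifold.  Near [u], where both cut-offs are 1, the identity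
    survives. *)
Lemma hadamard_chart U (x : 'I_n -> Cinf M) u f :
  admissible_chart (coord_chart U x) -> U u ->
  exists (g : 'I_n -> Cinf M), exists2 W, open W /\ W u &
    forall z, W z -> f z = f u + \sum_i (x i z - x i u) * g i z.
Proof.
set c := coord_chart U x => Ac Uu; have [ic oc _] := Ac.
pose a := cmap c u; pose F := chart_rep c f.
have [e e0 eV] : exists2 e : R, 0 < e & forall y, `|y - a| <= e ->
    (cmap c @` cdom c) y.
  by apply: nbhs_norm_radius; apply: open_nbhs_nbhs; split => //; exists u.
pose r := e / 2; have r0 : 0 < r by rewrite divr_gt0.
have e2r : e = 2 * r by rewrite /r mulrC divfK.
have Fs k : Ck k (cmap c @` cdom c) F by exact: chart_rep_smooth.
have Phis : smooth_on setT (fun y => box_bump a r y * F y).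
  move=> k; apply: Ck_local => y _.
  have [Vy|nVy] := pselect ((cmap c @` cdom c) y).
    exists (cmap c @` cdom c) => //; apply: Ck_mulf => //.
    by apply: Ck_sub (Ck_box_bump k a r).
  exists (~` [set y | `|y - a| <= e]).
    by split; [apply/closed_openC/closed_norm_ball|move=> /eV].
  apply: Ck_eq (Ck_cst k _ 0); first exact/closed_openC/closed_norm_ball.
  move=> z /= /negP; rewrite -ltNge e2r => /ltW za.
  by rewrite box_bump0// mul0r.
have [G Gs GE] := hadamard a Phis.
have oB : open (ball a r : set 'rV[R]_n) by exact: ball_open.
have [W [oW Wu Wc WF]] := cutoff_ext Ac Uu oB (ballxx a r0).
have /choice[g gE] : forall i, exists h : Cinf M, forall z, W z ->
  h z = G i (cmap c z).
  move=> i; have [|h [hE _]] := WF (G i); last by exists h.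
  by move=> k; apply: Ck_sub (Gs i k).
exists g, W => // z Wz; have [cz] := Wc z Wz; rewrite /= -ball_normE /= distrC
  => zr.
have := GE (cmap c z); rewrite box_bump1 ?ltW// mul1r /F chart_repE// => ->.
rewrite box_bump1 ?subrr ?normr0 ?ltW// mul1r /a chart_repE//; congr (_ + _).
by apply: eq_bigr => i _; rewrite gE// !mxE.
Qed.

(** Every A-point near [u] maps such a function to a unit; this makes A-points
    local. *)
Lemma test_function W u : open W -> W u ->
  exists psi : Cinf M, psi u = 1 /\ forall z, ~ W z -> psi z = 0.
Proof.
move=> oW Wu; have [c Ac0 cu] := atlas_cover u; have Ac := atlas_admissible Ac0.
have oI := chart_image_open Ac oW.
have [|W' [oW' W'u W'c W'F]] := cutoff_ext Ac cu oI; first by exists u.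
have [|h [h1 h0]] := W'F (cst 1); first by move=> k; exact: Ck_cst.
exists h; split; first exact: h1.
move=> z nW; apply: h0 => -[cz [t [ct Wt] tz]]; apply: nW.
suff <- : t = z by [].
by have [ic _ _] := Ac; apply: ic => //; exact: mem_set.
Qed.

End smooth_function_constructions.

Section points.
Context {R : realType} {n : nat} (M : manifold R n) {A : falgType R}
  (hA : weil_algebra A).
Implicit Types (p q : {lrmorphism Cinf M -> A}) (f g : Cinf M) (u : M).
Local Notation eps := (aug hA).

Lemma near_pointE p u : near_point p u <-> forall f, eps (p f) = f u.
Proof.
split=> [pu f|pu f]; first by apply: aug_unique; exact: pu.
by rewrite -[f u]pu; exact: augP.
Qed.

Lemma point_scalar p (c : R) : p c%:A = c%:A.
Proof. by rewrite linearZ rmorph1. Qed.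

Lemma pointB p f g : p (f - g) = p f - p g. Proof. exact: rmorphB. Qed.
Lemma pointD p f g : p (f + g) = p f + p g. Proof. exact: rmorphD. Qed.
Lemma pointM p f g : p (f * g) = p f * p g. Proof. exact: rmorphM. Qed.
Lemma point1 p : p 1 = 1. Proof. exact: rmorph1. Qed.
Lemma point0 p : p 0 = 0. Proof. exact: rmorph0. Qed.
Lemma point_sum p I (r : seq I) (P : pred I) (F : I -> Cinf M) :
  p (\sum_(i <- r | P i) F i) = \sum_(i <- r | P i) p (F i).
Proof. exact: rmorph_sum. Qed.

(** Otherwise the sum of the squares of the [f - eps (p f)] would be invertible,
    whereas [p] maps it to a nonunit. *)
Lemma common_value p (s : seq (Cinf M)) :
  exists v, forall f, f \in s -> f v = eps (p f).
Proof.
pose sq f : Cinf M := (f - (eps (p f))%:A) ^+ 2.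
have sqE f v : sq f v = (f v - eps (p f)) ^+ 2.
  by rewrite /sq !expr2 CinfM CinfB CinfZ Cinf1 mulr1.
pose g := \sum_(f <- s) sq f.
have [v gv] : exists v, g v = 0.
  apply: contrapT => H; have [|k gk] := @Cinf_inverse _ _ M g.
    by move=> v; apply/eqP => gv; apply: H; exists v.
  have : p g * p k \isn't a GRing.unit.
    apply: (nonunitMr hA); rewrite point_sum; apply: (nonunit_sum hA) => f _.
    rewrite /sq expr2 pointM; apply: (nonunitMr hA).
    by rewrite pointB point_scalar; exact: augP.
  by rewrite -pointM gk point1 unitr1.
exists v => f fs; apply/eqP; rewrite -subr_eq0 -sqrf_eq0 -sqE.
have := gv; rewrite Cinf_sum => /eqP.
rewrite psumr_eq0; last by move=> f' _; rewrite sqE sqr_ge0.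
by move=> /allP/(_ f fs).
Qed.


Lemma point_local p u f g W : near_point p u -> open W -> W u ->
  (forall z, W z -> f z = g z) -> p f = p g.
Proof.
move=> pu oW Wu fg; have [psi [psiu psi0]] := test_function oW Wu.
have pfg : (f - g) * psi = 0.
  apply: Cinf_ext => z; rewrite CinfM CinfB Cinf0.
  have [/fg ->|/psi0 ->] := pselect (W z); first by rewrite subrr mul0r.
  by rewrite mulr0.
have un : p psi \is a GRing.unit.
  apply/negPn; rewrite -(aug_eq0 hA); move/near_pointE : pu => ->.
  by rewrite psiu oner_eq0.
apply/eqP; rewrite -subr_eq0 -pointB -[p (f - g)](mulrK un) -pointM pfg.
by rewrite point0 mul0r.
Qed.

(** By Hadamard's lemma the difference of two A-points with equal coordinates
  is,
    for every [k], a combination of products of [k] nonunits. *)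
Lemma points_eq p q u U (x : 'I_n -> Cinf M) :
  admissible_chart (coord_chart U x) -> U u -> near_point p u ->
    near_point q u ->
  (forall i, p (x i) = q (x i)) -> forall f, p f = q f.
Proof.
move=> Ac Uu pu qu pq f; apply/eqP; rewrite -subr_eq0; apply/eqP.
suff H k : forall (s : seq A) f, all (fun a => a \isn't a GRing.unit) s ->
    (\dim {:A} <= size s + k)%N -> \prod_(a <- s) a * (p f - q f) = 0.
  by have := H (\dim {:A}) [::] f; rewrite big_nil mul1r; apply.
elim: k {f} => [|k IH] s f sn sk.
  by rewrite (prod_nonunits hA)// ?mul0r// -(addn0 (size s)).
have [g [W [oW Wu] gE]] := hadamard_chart f Ac Uu.
pose h : Cinf M := (f u : R)%:A + \sum_i (x i - (x i u : R)%:A) * g i.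
have fh z : W z -> f z = h z.
  move=> Wz; rewrite /h CinfD CinfZ Cinf1 mulr1 Cinf_sum gE//; congr (_ + _).
  by apply: eq_bigr => i _; rewrite CinfM CinfB CinfZ Cinf1 mulr1.
have pE (r : {lrmorphism Cinf M -> A}) : r h = (f u : R)%:A +
    \sum_i (r (x i) - (x i u : R)%:A) * r (g i).
  rewrite /h pointD point_sum point_scalar; congr (_ + _).
  by apply: eq_bigr => i _; rewrite pointM pointB point_scalar.
rewrite (point_local pu oW Wu fh) (point_local qu oW Wu fh) !pE.
rewrite opprD addrACA subrr add0r -sumrB mulr_sumr; apply: big1 => i _.
rewrite -pq -mulrBr mulrA -big_rcons/=; apply: IH.
  by rewrite all_rcons sn pu.
by rewrite size_rcons addSnnS.
Qed.

End points.

Section near_point_existence.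
Context {R : realType} {n : nat} (M : manifold R n).

(** Second countability: one bump is chosen for each basic open set on which
    some bump equals 1. *)
Lemma countable_bumps : exists psi : nat -> Cinf M,
  (forall u, exists j, exists2 W : set M, open W /\ W u & forall z, W z ->
    psi j z = 1) /\
  (forall j, psi j = 0 \/ exists U (x : 'I_n -> Cinf M),
     admissible_chart (coord_chart U x) /\ forall z, ~ U z -> psi j z = 0).
Proof.
have [_ _ [B /countable_injP[code codeI] [Bo Bb]] _ _] := manifoldP M.
pose supp (f : Cinf M) := f = 0 \/ exists U (x : 'I_n -> Cinf M),
  admissible_chart (coord_chart U x) /\ forall z, ~ U z -> f z = 0.
pose good j (f : Cinf M) := exists V, [/\ B V, code V = j & forall z, V z ->
  f z = 1].
have /choice[psi psiP] : forall j, exists f, supp f /\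
    ((exists f', supp f' /\ good j f') -> good j f).
  move=> j; have [[f [sf gf]]|nf] := pselect (exists f', supp f' /\ good j f').
    by exists f.
  by exists 0; split => //; left.
exists psi; split; last by move=> j; have [] := psiP j.
move=> u; have [U [x [Ac Uu [f [W [oW Wu] [f1 f0]]]]]] := coord_chart_ex u.
have [V [BV Vu] VW] : filter_from [set U | B U /\ U u] id W.
  by apply: Bb; exact: open_nbhs_nbhs.
have : exists f', supp f' /\ good (code V) f'.
  exists f; split; first by right; exists U, x.
  by exists V; split => // z /VW; exact: f1.
have [_ /[apply] [[V' [BV' V'V V'1]]]] := psiP (code V).
have {V'V} V'V : V' = V by apply: codeI => //; exact: mem_set.
exists (code V), V; first by split => //; exact: Bo.
by rewrite V'V in V'1.
Qed.

Section exhaustion.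
Variable psi : nat -> Cinf M.
Hypothesis psi1 : forall u, exists j, exists2 W : set M, open W /\ W u &
  forall z, W z -> psi j z = 1.

Let g (i : nat) : Cinf M := \prod_(j < i.+1) (1 - psi j) ^+ 2.

Let gE i z : g i z = \prod_(j < i.+1) (1 - psi j z) ^+ 2.
Proof. by rewrite Cinf_prod; apply: eq_bigr => j _;
  rewrite !expr2 CinfM CinfB Cinf1. Qed.

Let g0 j i z : psi j z = 1 -> (j <= i)%N -> g i z = 0.
Proof.
move=> p1 ji; rewrite gE (bigD1 (inord j))//= inordK//.
by rewrite p1 subrr expr0n mul0r.
Qed.

(** The function is the sum of the [\prod_(j < i.+1) (1 - psi j) ^+ 2].  It is
    locally finite, since near a point where some [psi j] is 1 only the first
    [j] products survive; and where the first [N] of the [psi j] vanish,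
      the first
    [N] products are 1. *)
Lemma exhaustion : exists h : Cinf M, forall z N,
  (forall j, (j < N)%N -> psi j z = 0) -> N%:R <= h z.
Proof.
have /choice[J JP] : forall z, exists j, psi j z = 1.
  by move=> z; have [j [W [_ Wz] W1]] := psi1 z; exists j; exact: W1.
have sumE a b z : psi a z = 1 -> psi b z = 1 ->
    \sum_(i < a) g i z = \sum_(i < b) g i z.
  wlog ab : a b / (a <= b)%N.
    by move=> H pa pb; case: (leqP a b) => [|/ltnW] ab; [|symmetry]; exact: H.
  move=> pa _; rewrite -(subnKC ab) big_split_ord/= [X in _ = _ + X]big1
    ?addr0//.
  by move=> i _; apply: g0 pa _; exact: leq_addr.
have [|h hE] := @Cinf_local _ _ M (fun z => \sum_(i < J z) g i z).
  move=> u; have [j [W oW W1]] := psi1 u.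
  exists (\sum_(i < j) g i), W => // z Wz.
  by rewrite Cinf_sum; apply: sumE => //; exact: W1.
exists h => z N z0; rewrite hE.
have NJ : (N <= J z)%N.
  rewrite leqNgt; apply/negP => JN; have := JP z; rewrite z0// => /eqP.
  by rewrite eq_sym oner_eq0.
rewrite -(subnKC NJ) big_split_ord/=.
rewrite (eq_bigr (fun=> 1)); last first.
  move=> i _; rewrite gE big1// => j _; rewrite z0 ?subr0 ?expr1n//.
  by apply: leq_trans (ltn_ord i); rewrite ltnS -ltnS; exact: ltn_ord.
rewrite sumr_const card_ord lerDl; apply: sumr_ge0 => i _.
by rewrite gE; apply: prodr_ge0 => j _; exact: sqr_ge0.
Qed.

End exhaustion.

(** Milnor's exercise.  For every finite family of functions,
  the values that [p]
    takes modulo the maximal ideal are attained together at some point.  Applied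
    to the exhaustion function, this shows that some bump [psi j] survives under
    [p]; then the coordinates of the chart carrying [psi j] single out one
      point,
    which must also give the value of every other function. *)
Lemma near_point_ex (A : falgType R) (hA : weil_algebra A)
  (p : {lrmorphism Cinf M -> A}) : exists u, near_point p u.
Proof.
have [psi [psi1 psi0]] := countable_bumps.
have [h hP] := exhaustion psi1.
have [j pj] : exists j, aug hA (p (psi j)) != 0.
  apply: contrapT => H.
  have H0 j : aug hA (p (psi j)) = 0.
    by apply/eqP; apply: contrapT => /negP nj; apply: H; exists j.
  (* Where [h] takes the value given by [p], it is less than [N]. *)
  pose N := Num.bound `|aug hA (p h)|.
  have [v vE] := common_value hA p (h :: [seq psi j | j <- iota 0 N]).
  have : N%:R <= h v.
    by apply: hP => j jN; rewrite vE ?H0// inE map_f ?orbT// mem_iota add0n jN.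
  rewrite vE ?mem_head//.
  apply/negP; rewrite -ltNge; apply: le_lt_trans (ler_norm _) _.
  exact: archi_boundP.
have [psij0|[U [x [Ac Ux0]]]] := psi0 j.
  by move: pj; rewrite psij0 point0 linear0 eqxx.
pose s := psi j :: [seq x i | i <- enum 'I_n].
have Hs (f : Cinf M) : exists v, [/\ U v, forall i,
  x i v = aug hA (p (x i)) & f v = aug hA (p f)].
  have [v vE] := common_value hA p (f :: s); exists v; split.
  - apply: contrapT => /Ux0 v0; move: pj; rewrite -vE ?v0 ?eqxx//.
    by rewrite !inE eqxx orbT.
  - by move=> i; apply: vE; rewrite !inE map_f ?orbT ?mem_enum.
  - by apply: vE; rewrite mem_head.
have [u [Uu xu _]] := Hs 0.
exists u; apply/(near_pointE hA) => f; have [v [Uv xv <-]] := Hs f.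
congr (f _); have [ic _ _] := Ac; apply: ic; try exact: mem_set.
by apply/rowP => i; rewrite !mxE xu xv.
Qed.

End near_point_existence.

(** * Taylor expansion with nilpotent increments *)

(** The induction step of the Leibniz formula for the powers of a derivation. *)
Lemma pascal_sum (R : comNzRingType) (V : lmodType R) (f : nat -> nat -> V) k :
  \sum_(j < k.+2) 'C(k.+1, j)%:R *: f j (k.+1 - j)%N =
  \sum_(j < k.+1) 'C(k, j)%:R *: (f j.+1 (k - j)%N + f j (k - j).+1).
Proof.
rewrite big_ord_recl /= bin0 subn0.
under eq_bigr => j _ do rewrite /bump leq0n add1n binS natrD scalerDl subSS.
rewrite big_split/= addrA addrC.
under [in RHS]eq_bigr => j _ do rewrite scalerDr.
rewrite [in RHS]big_split/=; congr (_ + _).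
rewrite big_ord_recr/= bin_small// scale0r addr0.
rewrite [RHS]big_ord_recl /= bin0 subn0; congr (_ + _).
by apply: eq_bigr => j _; rewrite /bump leq0n add1n subnSK.
Qed.

Section taylor.
Context {R : realType} {n : nat} {A : falgType R} (hA : weil_algebra A).
Implicit Types (F G : 'rV[R]_n -> R) (y : 'rV[R]_n) (V : set 'rV[R]_n)
  (nu : 'I_n -> A).
Local Notation nonunit a := (a \isn't a GRing.unit).

(** [taylor_term nu k F y] is the [k]-th power of the derivation
    [\sum_i nu i * partial i], applied to [F] and evaluated at [y]. *)
Fixpoint taylor_term nu (k : nat) F y : A :=
  if k is k'.+1 then \sum_i nu i * taylor_term nu k' (partial i F) y
  else (F y)%:A.

Lemma taylor_term_ext nu k V F G y : open V -> V y ->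
  (forall z, V z -> F z = G z) -> taylor_term nu k F y = taylor_term nu k G y.
Proof.
move=> oV Vy; elim: k F G => [|k IH] F G FG /=; first by rewrite FG.
apply: eq_bigr => i _; congr (_ * _); apply: IH => z Vz.
apply: near_eq_derive.
have nV : nbhs z V by apply: open_nbhs_nbhs.
by apply: filterS nV => t; exact: FG.
Qed.

Lemma taylor_term_lin nu k V F G y (a : R) : open V -> V y ->
  smooth_on V F -> smooth_on V G ->
  taylor_term nu k (fun z => a * F z + G z) y =
  a *: taylor_term nu k F y + taylor_term nu k G y.
Proof.
move=> oV Vy; elim: k F G => [|k IH] F G Fs Gs /=.
  by rewrite scalerDl scalerA.
rewrite scaler_sumr -big_split/=; apply: eq_bigr => i _.
rewrite scalerAr -mulrDr -IH; try exact: smooth_on_partial.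
congr (_ * _); apply: (taylor_term_ext _ _ oV Vy) => z Vz.
have dF := smooth_on_diff Fs Vz; have dG := smooth_on_diff Gs Vz.
rewrite /partial -[RHS]/(a *: 'D_(delta_mx 0 i) F z + 'D_(delta_mx 0 i) G z).
have dF' := diff_derivable (v := delta_mx 0 i) dF.
have dG' := diff_derivable (v := delta_mx 0 i) dG.
rewrite -deriveZ// -deriveD//; exact: derivableZ.
Qed.

Lemma taylor_termM nu k V F G y : open V -> V y ->
  smooth_on V F -> smooth_on V G ->
  taylor_term nu k (fun z => F z * G z) y =
  \sum_(j < k.+1) 'C(k, j)%:R *: (taylor_term nu j F y * taylor_term nu (k - j)
    G y).
Proof.
move=> oV Vy; elim: k F G => [|k IH] F G Fs Gs.
  by rewrite big_ord1 /= bin0 scale1r -scalerAl mul1r scalerA.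
rewrite (pascal_sum (fun a b => taylor_term nu a F y * taylor_term nu b G y))
  /=.
have ps H i : smooth_on V H -> smooth_on V (partial i H) by exact:
  smooth_on_partial.
have dE i : taylor_term nu k (partial i (fun z => F z * G z)) y =
    \sum_(j < k.+1) 'C(k, j)%:R *: (taylor_term nu j (partial i F) y *
        taylor_term nu (k - j) G y + taylor_term nu j F y *
        taylor_term nu (k - j) (partial i G) y).
  rewrite (@taylor_term_ext _ _ V _
    (fun z => 1 * (F z * partial i G z) + partial i F z * G z))//; last first.
    move=> z Vz; rewrite mul1r /partial.
    have dF := smooth_on_diff Fs Vz; have dG := smooth_on_diff Gs Vz.
    rewrite (@deriveM _ _ F G)//; try exact: diff_derivable.
    by rewrite -![_ *: _]/(_ * _) [X in _ + X]mulrC.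
  rewrite (taylor_term_lin _ _ _ oV Vy); last 2 first.
  - by move=> l; apply: Ck_mulf => //; exact: ps.
  - by move=> l; apply: Ck_mulf => //; exact: ps.
  rewrite scale1r !IH; try exact: ps; try by [].
  rewrite -big_split/=; apply: eq_bigr => j _; by rewrite -scalerDr addrC.
under eq_bigr => i _ do rewrite dE mulr_sumr.
rewrite exchange_big/=; apply: eq_bigr => j _.
under eq_bigr => i _ do rewrite -scalerAr.
rewrite -scaler_sumr; congr (_ *: _).
rewrite mulr_suml mulr_sumr -big_split/=; apply: eq_bigr => i _.
by rewrite mulrDr !mulrA [nu i * taylor_term nu j F y](weilC hA).
Qed.

(** The statement with a leading product of nonunits is the one that goes
    through the induction: each step moves a factor [nu i] into the product. *)
Lemma taylor_term_nil nu k F y (s : seq A) : (forall i, nonunit (nu i)) ->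
  all (fun a => nonunit a) s -> (\dim {:A} <= size s + k)%N ->
  \prod_(a <- s) a * taylor_term nu k F y = 0.
Proof.
move=> nun; elim: k F s => [|k IH] F s sn sk.
  by rewrite (prod_nonunits hA)// ?mul0r// -(addn0 (size s)).
rewrite /= mulr_sumr big1// => i _.
rewrite mulrA -big_rcons/=; apply: IH; first by rewrite all_rcons sn nun.
by rewrite size_rcons addSnnS.
Qed.

Lemma taylor_term_vanish nu k F y : (forall i, nonunit (nu i)) ->
  (\dim {:A} <= k)%N -> taylor_term nu k F y = 0.
Proof.
move=> nun Ak; have := @taylor_term_nil nu k F y [::] nun isT Ak.
by rewrite big_nil mul1r.
Qed.

Lemma taylor_term_cst nu k y (a : R) : taylor_term nu k.+1 (cst a) y = 0.
Proof.
elim: k a => [|k IH] a.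
  by rewrite /= big1// => i _; rewrite /partial derive_cst scale0r mulr0.
rewrite -[LHS]/(\sum_i nu i * taylor_term nu k.+1 (partial i (cst a)) y).
apply: big1 => i _.
have -> : partial i (cst a) = cst 0 :> ('rV[R]_n -> R).
  by apply/funext => z; rewrite /partial derive_cst.
by rewrite IH mulr0.
Qed.

(** Only the first [\dim {:A}] terms can be nonzero when all [nu i] are
  nonunits.
    Two more are summed so that the terms of degree 0 and 1 are always there. *)
Definition taylor nu F y : A :=
  \sum_(k < (\dim {:A}).+2) (k`!%:R : R)^-1 *: taylor_term nu k F y.

Lemma taylor_lin nu V F G y (a : R) : open V -> V y ->
  smooth_on V F -> smooth_on V G ->
  taylor nu (fun z => a * F z + G z) y = a *: taylor nu F y + taylor nu G y.
Proof.
move=> oV Vy Fs Gs; rewrite /taylor scaler_sumr -big_split/=.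
apply: eq_bigr => k _; rewrite (taylor_term_lin _ _ _ oV Vy)// scalerDr.
by rewrite !scalerA mulrC.
Qed.

Lemma taylor_ext nu V F G y : open V -> V y ->
  (forall z, V z -> F z = G z) -> taylor nu F y = taylor nu G y.
Proof.
move=> oV Vy FG; apply: eq_bigr => k _; congr (_ *: _).
exact: taylor_term_ext oV Vy FG.
Qed.

(** Cauchy products of the exponential series, read as an identity between
    polynomials in a formal parameter and evaluated at 1. *)
Lemma taylorM nu V F G y : (forall i, nonunit (nu i)) -> open V -> V y ->
  smooth_on V F -> smooth_on V G ->
  taylor nu (fun z => F z * G z) y = taylor nu F y * taylor nu G y.
Proof.
move=> nun oV Vy Fs Gs; set N := (\dim {:A}).+2.
pose P (H : 'rV[R]_n -> R) : {poly A} :=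
  \poly_(k < N) ((k`!%:R : R)^-1 *: taylor_term nu k H y).
have PE H k : (P H)`_k = (k`!%:R : R)^-1 *: taylor_term nu k H y.
  rewrite coef_poly; case: ltnP => // Nk; rewrite taylor_term_vanish ?scaler0//.
  exact: ltnW (ltnW Nk).
have P1 H : (P H).[1] = taylor nu H y.
  by rewrite horner_poly; apply: eq_bigr => k _; rewrite expr1n mulr1.
rewrite -!P1 -hornerM_comm; last by rewrite /comm_poly mulr1 mul1r.
congr (horner _ 1); apply/polyP => k; rewrite coefM PE.
rewrite (taylor_termM _ _ oV Vy)// scaler_sumr; apply: eq_bigr => j _.
rewrite !PE -scalerAl -scalerAr !scalerA; congr (_ *: _).
have jk : (j <= k)%N by rewrite -ltnS ltn_ord.
rewrite -(bin_fact jk) !natrM !invfM.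
have C0 : 'C(k, j)%:R != 0 :> R by rewrite pnatr_eq0 -lt0n bin_gt0.
by rewrite mulrAC mulVf// mul1r.
Qed.

Lemma taylor1 nu y : taylor nu (cst 1) y = 1.
Proof.
rewrite /taylor big_ord_recl big1 ?addr0; last first.
  by move=> k _; rewrite taylor_term_cst scaler0.
by rewrite /= fact0 invr1 scale1r scale1r.
Qed.

Lemma partial_coord i j : partial i (fun y => y 0 j : R) = cst (i == j)%:R.
Proof.
apply/funext => y; rewrite /partial.
have c : continuous (fun y : 'rV[R]_n => y 0 j : R) by exact:
  coord_mx_continuous.
rewrite deriveE; last exact: differentiable_coord.
rewrite (@diff_lin _ _ _ (mx_coord 0 j))//.
by rewrite /= /mx_coord mxE eqxx eq_sym.
Qed.

Lemma taylor_coord nu y j : taylor nu (fun z => z 0 j) y = (y 0 j)%:A + nu j.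
Proof.
have t0 k : taylor_term nu k.+2 (fun z => z 0 j) y = 0.
  rewrite -[LHS]/(\sum_i nu i * taylor_term nu k.+1 (partial i _) y) big1// =>
    i _.
  by rewrite partial_coord taylor_term_cst mulr0.
rewrite /taylor 2!big_ord_recl big1 ?addr0; last first.
  by move=> k _; rewrite t0 scaler0.
rewrite /= fact0 invr1 !scale1r; congr (_ + _).
rewrite (bigD1 j)//= big1 ?addr0 ?partial_coord ?eqxx ?scale1r ?mulr1//.
by move=> i ij; rewrite partial_coord (negbTE ij) scale0r mulr0.
Qed.

Lemma aug_taylor nu F y : (forall i, nonunit (nu i)) ->
  aug hA (taylor nu F y) = F y.
Proof.
move=> nun; apply: aug_unique.
rewrite /taylor big_ord_recl /= fact0 invr1 scale1r addrAC subrr add0r.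
apply: (nonunit_sum hA) => k _; apply: (nonunitZ hA).
by apply: (nonunit_sum hA) => i _; exact: (nonunitMr hA).
Qed.

(** The extension of a smooth function to A-valued coordinates: expand
    at the scalar parts along the nilpotent parts. *)
Definition prolong F (m : 'I_n -> A) : A :=
  taylor (fun i => m i - (aug hA (m i))%:A) F (\row_i aug hA (m i)).

End taylor.

(** * A-points with prescribed coordinates *)

Section weil_valued_smoothness.
Context {R : realType} {A : falgType R}.
Implicit Types (E : normedModType R).

(** Smoothness of an algebra-valued map, tested on the linear forms, so that
    the algebra needs no norm. *)
Definition wsmooth E (O : set E) (f : E -> A) : Prop :=
  forall l : A -> R, (forall c a b, l (c *: a + b) = c * l a + l b) ->
    forall k, Ck k O (l \o f).

Section functionals.
Variables (l : A -> R) (lP : forall c a b, l (c *: a + b) = c * l a + l b).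

Lemma functional0 : l 0 = 0.
Proof.
have := lP (-1) 0 0; rewrite scaler0 addr0 mulN1r addNr; exact.
Qed.

Lemma functionalD a b : l (a + b) = l a + l b.
Proof. by have := lP 1 a b; rewrite scale1r mul1r. Qed.

Lemma functionalZ c a : l (c *: a) = c * l a.
Proof. by have := lP c a 0; rewrite !addr0 functional0 addr0. Qed.

Lemma functional_sum I (r : seq I) (P : pred I) (F : I -> A) :
  l (\sum_(i <- r | P i) F i) = \sum_(i <- r | P i) l (F i).
Proof. by apply: (big_morph l functionalD functional0). Qed.

End functionals.

Lemma wsmooth_cst E (O : set E) (a : A) : wsmooth O (fun _ => a).
Proof. by move=> l _ k; exact: Ck_cst. Qed.

Lemma wsmoothD E (O : set E) f g : open O -> wsmooth O f -> wsmooth O g ->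
  wsmooth O (fun z => f z + g z).
Proof.
move=> oO fs gs l lP k; rewrite (_ : _ \o _ = fun z => (l \o f) z + (l \o g) z).
  by apply: Ck_addf; [|exact: fs|exact: gs].
by apply/funext => z; rewrite /= functionalD.
Qed.

Lemma wsmoothZ E (O : set E) (c : E -> R) f : open O -> (forall k, Ck k O c) ->
  wsmooth O f -> wsmooth O (fun z => c z *: f z).
Proof.
move=> oO cs fs l lP k; rewrite (_ : _ \o _ = fun z => c z * (l \o f) z).
  by apply: Ck_mulf => //; exact: fs.
by apply/funext => z; rewrite /= functionalZ.
Qed.

Lemma wsmooth_sum E (O : set E) I (r : seq I) (P : pred I) (F : I -> E -> A) :
  open O -> (forall i, wsmooth O (F i)) ->
  wsmooth O (fun z => \sum_(i <- r | P i) F i z).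
Proof.
move=> oO Fs l lP k.
rewrite (_ : _ \o _ = fun z => \sum_(i <- r | P i) (l \o F i) z).
  by apply: Ck_sum => // i _; exact: Fs.
by apply/funext => z; rewrite /= functional_sum.
Qed.

Lemma coord_functional m (e : m.-tuple A) i (c : R) (a b : A) :
  coord e i (c *: a + b) = c * coord e i a + coord e i b.
Proof. by rewrite linearD linearZ. Qed.

Lemma wsmoothM E (O : set E) f g : open O -> wsmooth O f -> wsmooth O g ->
  wsmooth O (fun z => f z * g z).
Proof.
move=> oO fs gs; pose e := vbasis {:A}.
have fe (h : E -> A) z : h z = \sum_i coord e i (h z) *: e`_i.
  by apply: coord_vbasis; exact: memvf.
rewrite (_ : (fun z => f z * g z) = fun z => \sum_i \sum_j
    (coord e i (f z) * coord e j (g z)) *: (e`_i * e`_j)).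
  do 2 (apply: wsmooth_sum => // ?).
  apply: wsmoothZ => //; last exact: wsmooth_cst.
  move=> k; apply: Ck_mulf => //.
    by apply: (fs (coord e _)); exact: coord_functional.
  by apply: (gs (coord e _)); exact: coord_functional.
apply/funext => z; rewrite [in LHS](fe f) [in LHS](fe g) mulr_suml.
apply: eq_bigr => i _; rewrite mulr_sumr; apply: eq_bigr => j _.
by rewrite -scalerAl -scalerAr scalerA.
Qed.

Lemma wsmooth_sub E (O O' : set E) f : O' `<=` O -> wsmooth O f -> wsmooth O' f.
Proof. by move=> OO fs l lP k; apply: Ck_sub OO _; exact: fs. Qed.

Section prolongation_smooth.
Context {n : nat} (hA : weil_algebra A).

Lemma aug_functional (c : R) (a b : A) :
  aug hA (c *: a + b) = c * aug hA a + aug hA b.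
Proof. by rewrite augD augZ. Qed.

(** The term is polynomial in the [nu i], with coefficients the iterated partial
    derivatives of [F]. *)
Lemma taylor_term_wsmooth E (O : set E) (V : set 'rV[R]_n) (y : E -> 'rV[R]_n)
    (nu : E -> 'I_n -> A) j F :
  open O -> open V -> (forall z, O z -> V (y z)) -> (forall k, Ck k O y) ->
  (forall i, wsmooth O (nu^~ i)) -> smooth_on V F ->
  wsmooth O (fun z => taylor_term (nu z) j F (y z)).
Proof.
move=> oO oV yV ys nus; elim: j F => [|j IH] F Fs /=.
  apply: wsmoothZ => //; last exact: wsmooth_cst.
  by move=> k; apply: Ck_comp oO oV yV (ys k) (Fs k).
apply: wsmooth_sum => // i; apply: wsmoothM => //.
by apply: IH; exact: smooth_on_partial.
Qed.

Lemma aug_row_smooth E (O : set E) (m : E -> 'I_n -> A) : open O ->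
  (forall i, wsmooth O (m^~ i)) ->
  forall k, Ck k O (fun z => \row_i aug hA (m z i)).
Proof.
move=> oO ms k; apply: Ck_mx => // i j.
under eq_fun do rewrite mxE.
by apply: (ms j (aug hA)) => *; exact: aug_functional.
Qed.

Lemma prolong_wsmooth E (O : set E) (V : set 'rV[R]_n) (m : E -> 'I_n -> A) F :
  open O -> open V -> (forall i, wsmooth O (m^~ i)) ->
  (forall z, O z -> V (\row_i aug hA (m z i))) -> smooth_on V F ->
  wsmooth O (fun z => prolong hA F (m z)).
Proof.
move=> oO oV ms mV Fs; rewrite /prolong /taylor.
apply: wsmooth_sum => // j; apply: wsmoothZ => //.
  by move=> k; exact: Ck_cst.
apply: (taylor_term_wsmooth (V := V)) => //.
  exact: aug_row_smooth.
move=> i; apply: wsmoothD => //.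
have -> : (fun z => - (aug hA (m z i))%:A) = fun z =>
  aug hA (m z i) *: (-1 : A).
  by apply/funext => z; rewrite scalerN.
apply: wsmoothZ => //; last exact: wsmooth_cst.
by apply: (ms i (aug hA)) => *; exact: aug_functional.
Qed.

End prolongation_smooth.
End weil_valued_smoothness.

Section points_from_coordinates.
Context {R : realType} {n : nat} (M : manifold R n).

Lemma lrmorphism_ext (A : falgType R) (p q : {lrmorphism Cinf M -> A}) :
  (forall f, p f = q f) -> p = q.
Proof.
move=> pq; case: p q pq => [p pc] [q qc] /= /funext pq; subst q.
congr GRing.LRMorphism.Pack; case: pc qc => [a b c] [a' b' c'].
have -> : a = a' by case: a a' => x [x']; congr Algebra.isNmodMorphism.Axioms_;
  exact: Prop_irrelevance.
have -> : b = b' by case: b b' => x [x']; congr GRing.isMonoidMorphism.Axioms_;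
  exact: Prop_irrelevance.
have -> // : c = c' by case: c c' => x [x']; congr GRing.isScalable.Axioms_;
  exact: Prop_irrelevance.
Qed.

Lemma point_of_fun (A : falgType R) (h : Cinf M -> A) : linear h ->
  (forall f g, h (f * g) = h f * h g) -> h 1 = 1 ->
  exists p : {lrmorphism Cinf M -> A}, forall f, p f = h f.
Proof.
move=> hl hM h1.
have hm : monoid_morphism h by split.
pose p : {lrmorphism Cinf M -> A} := HB.pack h
  (GRing.isLinear.Build R (Cinf M) A *:%R h hl)
  (GRing.isMonoidMorphism.Build (Cinf M) A h hm).
by exists p.
Qed.

Section coordinates.
Context {A : falgType R} (hA : weil_algebra A).
Variables (U : set M) (x : 'I_n -> Cinf M).
Hypothesis Ac : admissible_chart (coord_chart U x).
Local Notation c := (coord_chart U x).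

Lemma nilpart_nonunit (m : 'I_n -> A) i :
  m i - (aug hA (m i))%:A \isn't a GRing.unit.
Proof. exact: augP. Qed.

(** The A-point is obtained by reading each function in the chart and evaluating
    its prolongation at the prescribed coordinates. *)
Lemma point_of_coords u (m : 'I_n -> A) : U u ->
  (forall i, aug hA (m i) = x i u) ->
  exists p : {lrmorphism Cinf M -> A}, [/\ near_point p u,
    forall i, p (x i) = m i & forall f, p f = prolong hA (chart_rep c f) m].
Proof.
move=> Uu mu; have [ic oc _] := Ac.
have yE : \row_i aug hA (m i) = cmap c u by apply/rowP => i; rewrite !mxE mu.
have Vy : (cmap c @` cdom c) (\row_i aug hA (m i)) by rewrite yE; exists u.
have rs (f : Cinf M) : smooth_on (cmap c @` cdom c) (chart_rep c f).
  by move=> k; exact: chart_rep_smooth.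
have [||//|p pE] := @point_of_fun A (fun f => prolong hA (chart_rep c f) m).
- move=> a f g; rewrite /prolong.
  exact: (taylor_lin _ a oc Vy (rs f) (rs g)).
- move=> f g; rewrite /prolong.
  exact: (taylorM hA (nilpart_nonunit m) oc Vy (rs f) (rs g)).
- exact: taylor1.
exists p; split => //.
- apply/(near_pointE hA) => f; rewrite pE aug_taylor;
  last exact: nilpart_nonunit.
  by rewrite yE chart_repE.
- move=> i; rewrite pE /prolong.
  rewrite (@taylor_ext _ _ _ _ _ _ (fun y => y 0 i) _ oc Vy).
    by rewrite taylor_coord mxE subrKC.
  by move=> _ [v Uv <-]; rewrite chart_repE// mxE.
Qed.

(** The right-hand side, as a function of [f], is an A-point with the same
    coordinates as [p]. *)
Lemma prolong_eval (p : {lrmorphism Cinf M -> A}) u : near_point p u -> U u ->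
  forall f, p f = prolong hA (chart_rep c f) (fun i => p (x i)).
Proof.
move=> pu Uu f; have pu' := (near_pointE hA p u).1 pu.
have [|q [qu qx <-]] := @point_of_coords u (fun i => p (x i)) Uu.
  by move=> i; exact: pu'.
by apply: (points_eq hA Ac Uu pu qu) => i; rewrite qx.
Qed.

End coordinates.

End points_from_coordinates.

(** * Derivations into a square-zero ideal *)

Section surjection.
Context {R : realType} {A B : falgType R}
  (hA : weil_algebra A) (hB : weil_algebra B)
  (phi : {lrmorphism A -> B}) (phi_surj : forall b : B, exists a :
    A, phi a = b).
Local Notation I := (ker phi).

Lemma mem_ker a : a \in I = (phi a == 0).
Proof. by rewrite memv_ker lfunE. Qed.

(** A nonunit is nilpotent, and so is its image. *)
Lemma nonunit_image a : a \isn't a GRing.unit -> phi a \isn't a GRing.unit.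
Proof.
move=> na; apply/negP => un.
have : \prod_(b <- nseq (\dim {:A}) a) b = 0.
  by apply: (prod_nonunits hA); [rewrite all_nseq na orbT|rewrite size_nseq].
rewrite big_nseq iter_mulr_1 => /(congr1 phi); rewrite rmorphXn rmorph0.
by move=> e; have := unitrX (\dim {:A}) un; rewrite e unitr0.
Qed.

Lemma aug_image a : aug hB (phi a) = aug hA a.
Proof.
apply: aug_unique; have := nonunit_image (augP hA a).
by rewrite rmorphB /= linearZ rmorph1.
Qed.

Lemma aug_ker a : a \in I -> aug hA a = 0.
Proof. by rewrite mem_ker => /eqP a0; rewrite -aug_image a0 linear0. Qed.

(** A linear, in general not multiplicative, section of [phi]. *)
Definition sect (b : B) : A := ((linfun phi)^-1%VF b).

Lemma sectK b : phi (sect b) = b.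
Proof.
have fE a : linfun phi a = phi a by exact: lfunE.
rewrite -fE; apply: limg_lfunVK; have [a <-] := phi_surj b.
by rewrite -fE memv_img// memvf.
Qed.

Lemma sect_lin c a b : sect (c *: a + b) = c *: sect a + sect b.
Proof. by rewrite /sect linearP. Qed.

Lemma square_zeroP : (I ^+ 2)%VS = 0%VS <-> forall a b, a \in I -> b \in I ->
  a * b = 0.
Proof.
rewrite expv2; split => [I0 a b aI bI|H].
  by apply/eqP; rewrite -memv0 -I0 memv_mul.
apply/eqP; rewrite -subv0; apply/prodvP => a b aI bI.
by rewrite memv0 H.
Qed.

End surjection.

Section tangent.
Context {R : realType} {A B : falgType R}
  (hA : weil_algebra A) (hB : weil_algebra B)
  (phi : {lrmorphism A -> B}) (phi_surj : forall b : B, exists a : A, phi a = b)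
  {n : nat} (M : manifold R n).
Local Notation I := (ker phi).
Local Notation MA := (weil_bundle M A).
Local Notation MB := (weil_bundle M B).
Local Notation phihat := (@weil_map R n M A B phi).
Local Notation s := (sect phi).
Implicit Types (p q : MA) (b : MB) (D : Cinf M -> A) (f g : Cinf M) (u : M).

(** Points of the bundle as morphisms, so that they apply to functions. *)
Definition pt (C : falgType R) (p : weil_bundle M C) : {lrmorphism Cinf M ->
  C} := p.

Lemma phihatE p f : pt (phihat p) f = phi (pt p f). Proof. by []. Qed.

Lemma pt_inj (C : falgType R) (p q : weil_bundle M C) :
  (forall f, pt p f = pt q f) -> p = q.
Proof. by move=> pq; apply: lrmorphism_ext => f; exact: pq. Qed.

Lemma near_phihat p u : near_point (pt (phihat p)) u <-> near_point (pt p) u.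
Proof.
by split => /near_pointE H; apply/near_pointE => f;
  rewrite -H phihatE (aug_image hA hB).
Qed.

Lemma pt_eq_coords (C : falgType R) (hC : weil_algebra C) (p q :
  weil_bundle M C)
    u U (x : 'I_n -> Cinf M) : admissible_chart (coord_chart U x) -> U u ->
  near_point (pt p) u -> near_point (pt q) u ->
  (forall i, pt p (x i) = pt q (x i)) -> p = q.
Proof.
by move=> Ac Uu pu qu pq; apply: pt_inj; exact: (points_eq hC Ac Uu pu qu pq).
Qed.

(** Lift the coordinates of [b]; the A-point with the lifted coordinates lies
    over [b] because B-points are determined by their coordinates too. *)
Lemma lift_point b : exists p, phihat p = b.
Proof.
have [u bu] := near_point_ex hB (pt b).
have [U [x [Ac Uu _]]] := coord_chart_ex u.
have [|p [pu px _]] := point_of_coords (hA := hA) Ac Uu (m := fun i =>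
  s (pt b (x i))).
  by move=> i; rewrite -(aug_image hA hB phi) sectK//;
    exact: (near_pointE hB _ _).1.
exists p; apply: (pt_eq_coords hB Ac Uu) => //; first exact/near_phihat.
by move=> i; rewrite phihatE px sectK.
Qed.

(** The derivations over the lifts of [b].  As I is square-zero, they depend on
    [b] only, which a linear section of [phi] makes explicit. *)
Definition TV b : set (Cinf M -> A) :=
  [set D | [/\ linear D, forall f, D f \in I
             & forall f g, D (f * g) = s (pt b f) * D g + s (pt b g) * D f]].

Hypothesis I2 : forall a c, a \in I -> c \in I -> a * c = 0.

Lemma sect_mul p f a : a \in I -> s (pt (phihat p) f) * a = pt p f * a.
Proof.
move=> aI; apply/eqP; rewrite -subr_eq0 -mulrBl I2//.
by rewrite mem_ker rmorphB /= sectK// subrr.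
Qed.

Lemma derE p : der p I = TV (phihat p).
Proof.
apply/seteqP; split => D [Dl DI DM]; split => // f g.
  by rewrite !sect_mul// DM.
by rewrite DM !sect_mul.
Qed.

Lemma TV_subspace b : TV b 0 /\
  forall (a : R) D D', TV b D -> TV b D' -> TV b (a *: D + D').
Proof.
split.
  have z f : (0 : Cinf M -> A) f = 0 by [].
  split => [c f g|f|f g]; rewrite !z ?mem0v//.
  - by rewrite scaler0 addr0.
  - by rewrite !mulr0 addr0.
move=> a D D' [Dl DI DM] [D'l D'I D'M].
have z f : (a *: D + D') f = a *: D f + D' f by [].
split => [c f g|f|f g]; rewrite !z.
- by rewrite Dl D'l scalerDr addrACA scalerDr !scalerA mulrC.
- by rewrite memvD// memvZ.
- by rewrite DM D'M !mulrDr scalerDr !scalerAr addrACA.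
Qed.

(** In [(p + D) (f * g)] the only term that a derivation does not account for
    is [D f * D g], which lies in the square of the kernel. *)
Lemma add_point p D : TV (phihat p) D -> exists q,
  (forall f, pt q f = pt p f + D f) /\ phihat q = phihat p.
Proof.
move=> [Dl DI DM].
have [|||q qE] := @point_of_fun _ _ M A (fun f => pt p f + D f).
- by move=> c f g; rewrite linearP Dl scalerDr addrACA.
- move=> f g; rewrite pointM DM !sect_mul// mulrDl !mulrDr.
  by rewrite [D f * D g]I2// addr0 -addrA [D f * _](weilC hA).
- rewrite point1; have := DM 1 1; rewrite mulr1 !sect_mul// point1 !mul1r.
  by move/eqP; rewrite -subr_eq0 opprD addrA subrr sub0r oppr_eq0 => /eqP ->;
    rewrite addr0.
exists q; split=> //; apply: pt_inj => f; rewrite !phihatE /pt qE raddfD /=.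
by have := DI f; rewrite mem_ker => /eqP ->; rewrite addr0.
Qed.

Lemma sub_points p q : phihat q = phihat p ->
  TV (phihat p) (fun f => pt q f - pt p f).
Proof.
move=> qp.
have dI f : pt q f - pt p f \in I.
  by rewrite mem_ker rmorphB /= -!phihatE qp subrr.
split => // [c f g|f g].
  have pl r : pt r (c *: f + g) = c *: pt r f + pt r g by exact: linearP.
  by rewrite !pl opprD addrACA scalerBr.
rewrite !sect_mul// !pointM.
have uE h : pt q h = pt p h + (pt q h - pt p h) by rewrite subrKC.
rewrite {1}(uE f) {1}(uE g).
have uv0 := I2 (dI f) (dI g).
move: uv0; move: (pt q f - pt p f) (pt q g - pt p g) => u v uv.
rewrite mulrDl !mulrDr uv addr0 [u * _](weilC hA).
by rewrite addrAC [X in X + _ = _]addrAC subrr add0r.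
Qed.

(** The derivation with prescribed values [a i] on coordinates: the difference
    of the two lifts of [b] with coordinates [s (b x_i) + a i] and
    [s (b x_i)]. *)
Definition derivation_of c (bx : 'I_n -> B) (a : 'I_n -> A) f : A :=
  prolong hA (chart_rep c f) (fun i => s (bx i) + a i) -
  prolong hA (chart_rep c f) (fun i => s (bx i)).

Lemma derivation_ofP b u U (x : 'I_n -> Cinf M) (a : 'I_n -> A) :
  admissible_chart (coord_chart U x) -> U u -> near_point (pt b) u ->
  (forall i, a i \in I) ->
  TV b (derivation_of (coord_chart U x) (fun i => pt b (x i)) a) /\
  forall i, derivation_of (coord_chart U x) (fun i => pt b (x i)) a (x i) = a i.
Proof.
move=> Ac Uu bu aI; have bE := (near_pointE hB _ _).1 bu.
have sE i : aug hA (s (pt b (x i))) = x i u.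
  by rewrite -(aug_image hA hB phi) sectK//; exact: bE.
have [p [pu px pE]] := point_of_coords (hA := hA) Ac Uu sE.
have [|q [qu qx qE]] := point_of_coords (hA := hA) Ac Uu (m := fun i =>
  s (pt b (x i)) + a i).
  by move=> i; rewrite augD (aug_ker hA hB (aI i)) addr0.
have pb : phihat p = b.
  apply: (pt_eq_coords hB Ac Uu) => //; first exact/near_phihat.
  by move=> i; rewrite phihatE /pt px sectK.
have qb : phihat q = b.
  apply: (pt_eq_coords hB Ac Uu) => //; first exact/near_phihat.
  move=> i; rewrite phihatE /pt qx raddfD /= sectK//.
  by have := aI i; rewrite mem_ker => /eqP ->; rewrite addr0.
have DE f : derivation_of (coord_chart U x) (fun i =>
  pt b (x i)) a f = q f - p f.
  by rewrite qE pE.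
split; last by move=> i; rewrite DE px qx addrAC subrr add0r.
have -> : derivation_of (coord_chart U x) (fun i => pt b (x i)) a =
    fun f => pt q f - pt p f by apply/funext => f; rewrite DE.
by rewrite -{1}pb; apply: sub_points; rewrite pb.
Qed.

(** Adding the two derivations to a lift of [b] gives A-points with the same
    coordinates. *)
Lemma TV_eq b u U (x : 'I_n -> Cinf M) D D' :
  admissible_chart (coord_chart U x) -> U u -> near_point (pt b) u ->
  TV b D -> TV b D' -> (forall i, D (x i) = D' (x i)) -> D = D'.
Proof.
move=> Ac Uu bu DT DT' xx; have [p pb] := lift_point b; subst b.
have [q [qE qp]] := add_point DT; have [q' [qE' qp']] := add_point DT'.
have qq : q = q'.
  apply: (pt_eq_coords hA Ac Uu); last by move=> i; rewrite qE qE' xx.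
    by apply/near_phihat; rewrite qp.
  by apply/near_phihat; rewrite qp'.
by apply/funext => f; apply: (addrI (pt p f)); rewrite -qE -qE' qq.
Qed.

End tangent.

(** * Coordinates on bundles of A-points and on tangent spaces *)

Section values.
Context {R : realType} {A : falgType R} {n : nat}.

Definition vals d (e : d.-tuple A) (m : 'M[R]_(n, d)) (i : 'I_n) : A :=
  \sum_k m i k *: e`_k.

Lemma vals_coord d (e : d.-tuple A) (W : {vspace A}) (v : 'I_n -> A) :
  basis_of W e -> (forall i, v i \in W) ->
  forall i, vals e (\matrix_(i, k) coord e k (v i)) i = v i.
Proof.
move=> eW vW i; rewrite /vals [RHS](coord_basis eW (vW i)).
by apply: eq_bigr => k _; rewrite mxE.
Qed.

Lemma coord_vals d (e : d.-tuple A) (W : {vspace A}) m i k :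
  basis_of W e -> coord e k (vals e m i) = m i k.
Proof.
by move=> /basis_free ef; rewrite /vals coord_sum_free.
Qed.

Lemma vals_mem d (e : d.-tuple A) (W : {vspace A}) m i :
  basis_of W e -> vals e m i \in W.
Proof.
move=> eW; apply: memv_suml => k _; apply/memvZ/(basis_mem eW).
by apply: mem_nth; rewrite size_tuple.
Qed.

Lemma vals_wsmooth (E : normedModType R) (O : set E) d (e : d.-tuple A)
    (f : E -> 'M[R]_(n, d)) i : open O ->
  (forall j k l, Ck l O (fun z => f z j k : R)) -> wsmooth O (fun z =>
    vals e (f z) i).
Proof.
move=> oO fs; apply: wsmooth_sum => // k; apply: wsmoothZ => //.
exact: wsmooth_cst.
Qed.

Lemma coord_wsmooth (E : normedModType R) (O : set E) d (e : d.-tuple A)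
    (f : E -> 'I_n -> A) k : open O -> (forall i, wsmooth O (f^~ i)) ->
  Ck k O (fun z => \matrix_(i, j) coord e j (f z i) : 'M[R]_(n, d)).
Proof.
move=> oO fs; apply: Ck_mx => // i j.
rewrite (_ : (fun _ => _) = coord e j \o f^~ i).
  by apply: (fs i (coord e j)); exact: coord_functional.
by apply/funext => z; rewrite /= mxE.
Qed.

Lemma Ck_fst a b (F : normedModType R) k (O : set ('M[R]_(a, b) * F)%type) i j :
  Ck k O (fun z => z.1 i j : R).
Proof.
pose L : {linear ('M[R]_(a, b) * F)%type -> R} := mx_coord i j \o fst.
apply: (@Ck_lin _ k _ _ O L) => z.
apply: (@continuous_comp _ _ _ fst (mx_coord i j));
  last exact: coord_mx_continuous.
exact: cvg_fst.
Qed.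

Lemma Ck_snd a b (F : normedModType R) k (O : set (F * 'M[R]_(a, b))%type) i j :
  Ck k O (fun z => z.2 i j : R).
Proof.
pose L : {linear (F * 'M[R]_(a, b))%type -> R} := mx_coord i j \o snd.
apply: (@Ck_lin _ k _ _ O L) => z.
apply: (@continuous_comp _ _ _ snd (mx_coord i j));
  last exact: coord_mx_continuous.
exact: cvg_snd.
Qed.

Lemma vec_mxE a b (v : 'rV[R]_(a * b)) i k : vec_mx v i k = v 0 (mxvec_index i
  k).
Proof. by rewrite -[in RHS](vec_mxK v) mxvecE. Qed.

End values.

Section weil_charts.
Context {R : realType} {n : nat} (M : manifold R n) {C : falgType R}
  (hC : weil_algebra C).

Definition near_dom (U : set M) : set (weil_bundle M C) :=
  [set p | exists2 u, U u & near_point (pt p) u].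

Definition weil_chart (U : set M) (x : 'I_n ->
  Cinf M) (e : (\dim {:C}).-tuple C) :
    chart (weil_bundle M C) 'M[R]_(n, \dim {:C}) :=
  Chart (near_dom U) (fun p => \matrix_(i, k) coord e k (pt p (x i))).

Lemma weil_chart_atlas U x (e : (\dim {:C}).-tuple C) :
  admissible_chart (coord_chart U x) ->
  basis_of {:C} e -> atlas (weil_chart U x e).
Proof. by move=> Ac eb; exists U, x, e. Qed.

Lemma weil_atlasE (c : chart (weil_bundle M C) 'M[R]_(n, \dim {:C})) :
  atlas c ->
  exists U x (e : (\dim {:C}).-tuple C), [/\ admissible_chart (coord_chart U
    x), basis_of {:C} e &
    c = weil_chart U x e].
Proof. by move=> [U [x [e [Ac eb ->]]]]; exists U, x, e. Qed.

Lemma near_dom_open U x : admissible_chart (coord_chart U x) ->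
  open (near_dom U).
Proof.
move=> Ac; have := atlas_open (weil_chart_atlas Ac (vbasisP {:C})) openT.
by rewrite preimage_setT setIT.
Qed.

Lemma weil_chart_vals U x (e : (\dim {:C}).-tuple C) (p : weil_bundle M C) :
  basis_of {:C} e -> vals e (cmap (weil_chart U x e) p) = fun i => pt p (x i).
Proof.
move=> eb; apply/funext => i; apply: (vals_coord (v := fun i =>
  pt p (x i)) eb) => *.
exact: memvf.
Qed.

(** The values at an A-point of functions, as a smooth function of the
    coordinates of the A-point. *)
Lemma prolong_chart_eval U x (e : (\dim {:C}).-tuple C) (p :
  weil_bundle M C) f :
  admissible_chart (coord_chart U x) -> basis_of {:C} e -> near_dom U p ->
  pt p f = prolong hC (chart_rep (coord_chart U x) f)
             (vals e (cmap (weil_chart U x e) p)).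
Proof.
move=> Ac eb [u Uu pu]; rewrite weil_chart_vals//.
exact: (prolong_eval hC Ac pu Uu).
Qed.

Lemma aug_row_point (x : 'I_n -> Cinf M) (p : weil_bundle M C) u :
  near_point (pt p) u -> \row_i aug hC (pt p (x i)) = \row_i (x i u : R).
Proof. by move=> /(near_pointE hC) pu; apply/rowP => i; rewrite !mxE pu. Qed.

End weil_charts.

Section bundle_structure.
Context {R : realType} {A B : falgType R}
  (hA : weil_algebra A) (hB : weil_algebra B)
  (phi : {lrmorphism A -> B}) (phi_surj : forall b : B, exists a : A, phi a = b)
  {n : nat} (M : manifold R n).
Local Notation I := (ker phi).
Local Notation MA := (weil_bundle M A).
Local Notation MB := (weil_bundle M B).
Local Notation phihat := (@weil_map R n M A B phi).
Local Notation s := (sect phi).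
Local Notation iota := (vbasis (ker phi)).
Local Notation r := (n * \dim (ker phi))%N.
Hypothesis I2 : forall a c, a \in I -> c \in I -> a * c = 0.
Implicit Types (p q : MA) (b : MB) (D : Cinf M -> A) (f g : Cinf M) (u : M)
  (U : set M) (x : 'I_n -> Cinf M).

Definition tangent_coord x D : 'rV[R]_r :=
  mxvec (\matrix_(i, k) coord iota k (D (x i))).

Definition tangent_chart U x : vb_chart (Cinf M -> A) MB r :=
  VBChart (near_dom (C := B) U) (fun _ => tangent_coord x).

Definition tangent_charts : set (vb_chart (Cinf M -> A) MB r) :=
  [set c | exists U x, admissible_chart (coord_chart U x) /\ c = tangent_chart
    U x].

Definition tangent_vals (w : 'rV[R]_r) : 'I_n -> A := vals iota (vec_mx w).

Lemma tangent_vals_ker w i : tangent_vals w i \in I.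
Proof. exact: vals_mem (vbasisP _). Qed.

Lemma tangent_coordK x D : (forall f, D f \in I) ->
  tangent_vals (tangent_coord x D) = fun i => D (x i).
Proof.
move=> DI; rewrite /tangent_vals /tangent_coord mxvecK.
by apply/funext => i; apply: (vals_coord (v := fun i =>
  D (x i)) (vbasisP _)) => *.
Qed.

Lemma tangent_coord_vals x D w : (forall i, D (x i) = tangent_vals w i) ->
  tangent_coord x D = w.
Proof.
move=> Dw; rewrite /tangent_coord -[RHS]vec_mxK; congr mxvec.
apply/matrixP => i k; rewrite mxE Dw /tangent_vals.
exact: coord_vals (vbasisP _).
Qed.

Lemma tangent_coord_lin x (a : R) D D' :
  tangent_coord x (a *: D + D') = a *: tangent_coord x D + tangent_coord x D'.
Proof.
rewrite /tangent_coord -linearP; congr mxvec; apply/matrixP => i k;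
  rewrite !mxE.
exact: coord_functional.
Qed.

Definition lift_derivation U x (bx : 'I_n -> B) (w : 'rV[R]_r) : Cinf M -> A :=
  derivation_of hA phi (coord_chart U x) bx (tangent_vals w).

Lemma lift_derivationP U x b u w : admissible_chart (coord_chart U x) -> U u ->
  near_point (pt b) u ->
  TV phi b (lift_derivation U x (fun i => pt b (x i)) w) /\
  tangent_coord x (lift_derivation U x (fun i => pt b (x i)) w) = w.
Proof.
move=> Ac Uu bu.
have [TD DE] := derivation_ofP hA hB phi_surj I2 Ac Uu bu (tangent_vals_ker w).
by split => //; exact: tangent_coord_vals.
Qed.

Lemma tangent_coord_inj U x b u D D' : admissible_chart (coord_chart U x) ->
  U u ->
  near_point (pt b) u -> TV phi b D -> TV phi b D' ->
  tangent_coord x D = tangent_coord x D' -> D = D'.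
Proof.
move=> Ac Uu bu TD TD' e; apply: (TV_eq hA hB phi_surj I2 Ac Uu bu TD TD') => i.
have [_ DI _] := TD; have [_ D'I _] := TD'.
by have := congr1 (@^~ i \o tangent_vals) e; rewrite /= !tangent_coordK.
Qed.

(** The transition matrix depends on the B-point through the values [bx] that it
    gives to the coordinates [x], and these are smooth in any chart. *)
Definition transition U x (y : 'I_n -> Cinf M) (bx : 'I_n -> B) : 'M[R]_r :=
  \matrix_j tangent_coord y (lift_derivation U x bx (delta_mx 0 j)).

Lemma TV_sum b (J : finType) (c : J -> R) (D : J -> Cinf M -> A) :
  (forall j, TV phi b (D j)) -> TV phi b (\sum_j c j *: D j).
Proof.
have [T0 TD] := TV_subspace phi b.
move=> DT; apply: big_ind => //.
  by move=> D1 D2 T1 T2; rewrite -[D1]scale1r; exact: TD.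
by move=> j _; rewrite -[_ *: _]addr0; exact: TD.
Qed.

(** Both sides are linear in [D], and the derivations [lift_derivation] at the
    standard basis vectors form a basis of the tangent space. *)
Lemma transitionP U x (y : 'I_n -> Cinf M) b u D :
  admissible_chart (coord_chart U x) -> U u -> near_point (pt b) u ->
  TV phi b D ->
  tangent_coord y D =
    tangent_coord x D *m transition U x y (fun i => pt b (x i)).
Proof.
move=> Ac Uu bu TD; set w := tangent_coord x D.
pose Dj j := lift_derivation U x (fun i => pt b (x i)) (delta_mx 0 j).
have tl (z : 'I_n -> Cinf M) (c : 'I_r -> R) :
    tangent_coord z (\sum_j c j *: Dj j) = \sum_j c j *: tangent_coord z (Dj j).
  have t0 : tangent_coord z 0 = 0.
    by have := tangent_coord_lin z (-1) 0 0; rewrite scaler0 addr0 scaleN1r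
      addNr.
  apply: (big_rec2 (fun D1 v => tangent_coord z D1 = v)) => // j D1 v _ <-.
  by rewrite tangent_coord_lin.
have DE : D = \sum_j w 0 j *: Dj j.
  apply: (tangent_coord_inj Ac Uu bu TD).
    by apply: TV_sum => j; have [] := lift_derivationP (delta_mx 0 j) Ac Uu bu.
  rewrite tl -/w [LHS]row_sum_delta; apply: eq_bigr => j _.
  by have [_ ->] := lift_derivationP (delta_mx 0 j) Ac Uu bu.
rewrite [in LHS]DE tl mulmx_sum_row; apply: eq_bigr => j _.
by rewrite /transition rowK.
Qed.

Lemma sect_wsmooth (E : normedModType R) (O : set E) (h : E -> B) :
  open O -> wsmooth O h -> wsmooth O (fun z => s (h z)).
Proof.
move=> oO hs l lP k; apply: (hs (l \o s)) => c a b /=.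
by rewrite sect_lin lP.
Qed.

Lemma transition_smooth (E : normedModType R) (O : set E) U x y
    (bx : E -> 'I_n -> B) k : open O -> admissible_chart (coord_chart U x) ->
  (forall i, wsmooth O (bx^~ i)) ->
  (forall z, O z -> (cmap (coord_chart U x) @` U) (\row_i aug hB (bx z i))) ->
  Ck k O (fun z => transition U x y (bx z)).
Proof.
move=> oO Ac bs bU; have [_ oc _] := Ac.
apply: Ck_mx => // j l; case/mxvec_indexP : l => i m.
pose h z := lift_derivation U x (bx z) (delta_mx 0 j) (y i).
rewrite (_ : (fun _ => _) = coord iota m \o h); last first.
  apply/funext => z; rewrite /transition mxE /tangent_coord mxvecE mxE.
  by [].
suff hs : wsmooth O h by apply: (hs (coord iota m)); exact: coord_functional.
have fs (a : 'I_n -> A) : (forall i, a i \in I) ->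
    wsmooth O (fun z => prolong hA (chart_rep (coord_chart U x) (y i))
      (fun i => s (bx z i) + a i)).
  move=> aI; apply: (prolong_wsmooth (V := cmap (coord_chart U x) @` U)) => //.
  - move=> i'; apply: wsmoothD => //; last exact: wsmooth_cst.
    by apply: sect_wsmooth => //; exact: bs.
  - move=> z Oz; rewrite (_ : \row_i' _ = \row_i' aug hB (bx z i'));
    first exact: bU.
    apply/rowP => i'; rewrite !mxE augD (aug_ker hA hB (aI i')) addr0.
    by rewrite -(aug_image hA hB phi) sectK.
  - by move=> k'; exact: (chart_rep_smooth (y i) k' Ac).
rewrite /h /lift_derivation /derivation_of.
apply: wsmoothD => //; first by apply: fs => i'; exact: tangent_vals_ker.
have fs0 := fs (fun=> 0) (fun=> mem0v _).
rewrite (_ : (fun z => - _) = fun z => (-1 : R) *: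
  prolong hA (chart_rep (coord_chart U x) (y i))
      (fun i => s (bx z i) + 0)).
  by apply: wsmoothZ => // k'; exact: Ck_cst.
apply/funext => z; rewrite scaleN1r; congr (- prolong _ _ _).
by apply/funext => i'; rewrite addr0.
Qed.

End bundle_structure.

(** * The affine bundle structure, and the converse *)

Lemma open_aug_row (R : realType) (C : falgType R) (hC : weil_algebra C) n
    (E : normedModType R) (O : set E) (V : set 'rV[R]_n) (m : E -> 'I_n -> C) :
  open O -> open V -> (forall i, wsmooth O (m^~ i)) ->
  open (O `&` (fun z => \row_i aug hC (m z i)) @^-1` V).
Proof.
move=> oO oV ms; apply: open_preimage => //.
exact: (@aug_row_smooth _ _ _ hC _ _ _ oO ms 0%N).
Qed.

Section affine_structure.
Context {R : realType} {A B : falgType R}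
  (hA : weil_algebra A) (hB : weil_algebra B)
  (phi : {lrmorphism A -> B}) (phi_surj : forall b : B, exists a : A, phi a = b)
  {n : nat} (M : manifold R n).
Local Notation I := (ker phi).
Local Notation MA := (weil_bundle M A).
Local Notation MB := (weil_bundle M B).
Local Notation phihat := (@weil_map R n M A B phi).
Hypothesis I2 : forall a c, a \in I -> c \in I -> a * c = 0.

Lemma near_dom_cover (C : falgType R) (hC : weil_algebra C) (p :
  weil_bundle M C) :
  exists U (x : 'I_n -> Cinf M), admissible_chart (coord_chart U x) /\ near_dom
    U p.
Proof.
have [u pu] := near_point_ex hC (pt p).
by have [U [x [Ac Uu _]]] := coord_chart_ex u; exists U, x; split => //;
  exists u.
Qed.

(** Smoothness of the transitions is checked in the chart of M^B given by
    coordinates [z] on [W]: there the values at [b] of the coordinates [x] are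
    prolongations of smooth functions of the [z i]. *)
Lemma tangent_vector_bundle : vector_bundle (TV phi (M := M)) (@tangent_charts
  _ _ _ phi _ M).
Proof.
split.
- exact: TV_subspace.
- move=> b; have [U [x [Ac Ub]]] := near_dom_cover hB b.
  by exists (tangent_chart phi U x); first by exists U, x.
- move=> _ [U [x [Ac ->]]]; split; first exact: (near_dom_open Ac).
  move=> b [u Uu bu]; split; last first.
    by move=> a D D' _ _; exact: tangent_coord_lin.
  split => //.
    move=> D D' /set_mem TD /set_mem TD' e.
    exact: (tangent_coord_inj hA hB phi_surj I2 Ac Uu bu TD TD' e).
  move=> w _; have [TD DE] := lift_derivationP hA hB phi_surj I2 w Ac Uu bu.
  by eexists; [exact: TD|exact: DE].
move=> _ _ [U [x [Acx ->]]] [V [y [Acy ->]]].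
exists (fun b => transition hA phi U x y (fun i => pt b (x i))); last first.
  move=> b D [u Uu bu] _ TD.
  exact: (transitionP hA hB phi_surj I2 y Acx Uu bu TD).
move=> _ /weil_atlasE[W [z [e [Acz eb ->]]]].
have [_ ox _] := Acx; have [_ oz _] := Acz.
(* [O1] bounds the B-points near [W], [O2] those that are also near [U]. *)
pose O1 : set 'M[R]_(n, \dim {:B}) :=
  setT `&` (fun m => \row_i aug hB (vals e m i)) @^-1` (cmap (coord_chart W z)
    @` W).
have vs O' : open O' -> forall i,
    wsmooth O' (fun m : 'M[R]_(n, \dim {:B}) => vals e m i).
  move=> oO' i; apply: (vals_wsmooth e i (f := id)) => // j k l.
  exact: (Ck_mx_coord l j k).
have oO1 : open O1 by apply: open_aug_row => //; [exact: openT|exact: vs openT].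
pose bx (m : 'M[R]_(n, \dim {:B})) i :=
  prolong hB (chart_rep (coord_chart W z) (x i)) (vals e m).
have bxs i : wsmooth O1 (bx^~ i).
  apply: (prolong_wsmooth (V := cmap (coord_chart W z) @` W)) => //.
  - exact: vs.
  - by move=> m [].
  - by move=> k; exact: (chart_rep_smooth (x i) k Acz).
pose O2 := O1 `&` (fun m => \row_i aug hB (bx m i)) @^-1` (cmap (coord_chart U
  x) @` U).
have oO2 : open O2 by exact: open_aug_row.
have bxE b : near_dom W b -> bx (cmap (weil_chart W z e) b) = fun i =>
  pt b (x i).
  by move=> Wb; apply/funext => i; rewrite /bx -prolong_chart_eval.
exists (fun m => transition hA phi U x y (bx m)).
  move=> k; apply: (@Ck_sub _ _ _ k O2).
    move=> _ [b [Wb [[u Uu bu] _]] <-]; split.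
      split => //; have [w Ww bw] := Wb; exists w => //.
      by rewrite weil_chart_vals// (aug_row_point hB z bw).
    by rewrite /= bxE//; exists u => //; rewrite (aug_row_point hB x bu).
  apply: transition_smooth => //.
  - by move=> i; apply: wsmooth_sub (bxs i) => m [].
  - by move=> m [].
by move=> b [Wb _]; rewrite bxE.
Qed.

Local Notation fibprod := (total_space (TV phi (M := M) \o phihat)
  (pullback phihat (@tangent_charts _ _ _ phi _ M))).

Lemma add_ex (z : fibprod) : exists q : MA,
  (forall f, pt q f = pt (sval z).1 f + (sval z).2 f) /\
  phihat q = phihat (sval z).1.
Proof. exact: (add_point hA phi_surj I2 (svalP z)). Qed.

Definition add_map (z : fibprod) : MA := projT1 (cid (add_ex z)).

Lemma add_mapE (z : fibprod) f :
  pt (add_map z) f = pt (sval z).1 f + (sval z).2 f.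
Proof. by have [H _] := projT2 (cid (add_ex z)); exact: H. Qed.

Lemma phihat_add (z : fibprod) : phihat (add_map z) = phihat (sval z).1.
Proof. by have [_ H] := projT2 (cid (add_ex z)). Qed.

Lemma near_add (z : fibprod) u :
  near_point (pt (add_map z)) u <-> near_point (pt (sval z).1) u.
Proof.
by split => zu; apply/(near_phihat hA hB phi);
  [rewrite -phihat_add|rewrite phihat_add]; exact/(near_phihat hA hB phi).
Qed.

Lemma near_dom_add U (z : fibprod) : near_dom U (add_map z) <-> near_dom U
  (sval z).1.
Proof. by split => -[u Uu zu]; exists u => //; exact/near_add. Qed.

Lemma near_dom_phihat U (p : MA) : near_dom U (phihat p) <-> near_dom U p.
Proof. by split => -[u Uu pu]; exists u => //; exact/(near_phihat hA hB). Qed.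

Definition fibprod_chart U (x : 'I_n -> Cinf M) (e : (\dim {:A}).-tuple A)
    W (w : 'I_n -> Cinf M) : chart fibprod ('M[R]_(n,
      \dim {:A}) * 'rV[R]_(n * \dim I))%type :=
  Chart [set z : fibprod | near_dom U (sval z).1 /\ near_dom W (phihat (sval
    z).1)]
    (fun z => (cmap (weil_chart U x e) (sval z).1,
      tangent_coord phi w (sval z).2)).

Lemma fibprod_chart_atlas U x (e : (\dim {:A}).-tuple A) W w :
  admissible_chart (coord_chart U x) ->
  basis_of {:A} e -> admissible_chart (coord_chart W w) ->
  atlas (fibprod_chart U x e W w).
Proof.
move=> Ax eb Aw.
exists (weil_chart U x e), (VBChart (phihat @^-1` near_dom W)
  ((fun _ => tangent_coord phi w) \o phihat)); split.
- exact: weil_chart_atlas.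
- by exists (tangent_chart phi W w) => //; exists W, w.
- by [].
Qed.

Lemma fibprod_atlasE c : atlas c -> exists U x (e : (\dim {:A}).-tuple A) W w,
  [/\ admissible_chart (coord_chart U x), basis_of {:A} e,
      admissible_chart (coord_chart W w) & c = fibprod_chart U x e W w].
Proof.
move=> [c1 [d1 [/weil_atlasE[U [x [e [Ax eb ->]]]] [_ [W [w [Aw ->]] <-] ->]]]].
by exists U, x, e, W, w.
Qed.

Lemma TV_ker (z : fibprod) f : (sval z).2 f \in I.
Proof. by have [_ H _] := svalP z; exact: H. Qed.

(** When the A-point, the derivation and their sum are all read in one
  coordinate
    system [y], the addition law is linear. *)
Lemma add_continuous : continuous add_map.
Proof.
move=> z; apply: atlas_cvg => _ O /weil_atlasE[V [y [e [Ay eb ->]]]] oO Vz Oz.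
pose F := ('M[R]_(n, \dim {:A}) * 'rV[R]_(n * \dim I))%type.
pose L (m : F) : 'M[R]_(n, \dim {:A}) :=
  \matrix_(i, k) coord e k (vals e m.1 i + tangent_vals m.2 i).
have Lc : Ck 0 setT L.
  apply: (coord_wsmooth e (f := fun (m : F) i =>
    vals e m.1 i + tangent_vals m.2 i)) => //.
    exact: openT.
  move=> i; apply: wsmoothD; first exact: openT.
    apply: vals_wsmooth; first exact: openT.
    by move=> j k l; exact: Ck_fst.
  apply: (vals_wsmooth _ _ (f := fun m : F => vec_mx m.2)); first exact: openT.
  move=> j k l; under eq_fun do rewrite vec_mxE; exact: Ck_snd.
have LE (t : fibprod) : near_dom V (sval t).1 ->
    cmap (weil_chart V y e) (add_map t) = L (cmap (fibprod_chart V y e V y) t).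
  move=> Vt; apply/matrixP => i k; rewrite !mxE /=; congr (coord e k _).
  rewrite add_mapE; congr (_ + _).
    by rewrite -[vals _ _]/(vals e (cmap (weil_chart V y e) (sval t).1))
      weil_chart_vals.
  by rewrite tangent_coordK// => f; exact: TV_ker.
have oL : open (setT `&` L @^-1` O).
  by apply: open_preimage => //; exact: openT.
have oS := atlas_open (fibprod_chart_atlas Ay eb Ay) oL.
have Vz1 : near_dom V (sval z).1 by exact/near_dom_add.
have nS : nbhs z (cdom (fibprod_chart V y e V y) `&`
    cmap (fibprod_chart V y e V y) @^-1` (setT `&` L @^-1` O)).
  apply: open_nbhs_nbhs; split => //; split.
    by split => //; exact/near_dom_phihat.
  by split => //=; rewrite -LE.
apply: filterS nS => t [[Vt _] [_ Ot]]; split; first exact/near_dom_add.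
by rewrite LE.
Qed.

(** The A-point is read in coordinates [x], the derivation in coordinates [w]
  and
    the sum in coordinates [y].  So the A-point is first passed to [w],
      where the
    addition is linear, and the sum is then passed to [y]. *)
Lemma add_smooth : smooth_map add_map.
Proof.
split; first exact: add_continuous.
move=> c d /fibprod_atlasE[U [x [e [W [w [Ax eb Aw ->{c}]]]]]].
move=> /weil_atlasE[V [y [e' [Ay eb' ->{d}]]]].
have [_ ox _] := Ax; have [_ ow _] := Aw; have [_ oy _] := Ay.
pose F := ('M[R]_(n, \dim {:A}) * 'rV[R]_(n * \dim I))%type.
have vs O' : open O' -> forall i, wsmooth O' (fun m : F => vals e m.1 i).
  move=> oO' i; apply: vals_wsmooth => // j k l; exact: Ck_fst.
pose O1 : set F := setT `&` (fun m => \row_i aug hA (vals e m.1 i)) @^-1`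
  (cmap (coord_chart U x) @` U).
have oO1 : open O1.
  by apply: (@open_aug_row _ _ hA _ _ setT _ (fun m : F => vals e m.1)) => //;
    [exact: openT|exact: vs openT].
pose qw (m : F) i :=
  prolong hA (chart_rep (coord_chart U x) (w i)) (vals e m.1) + tangent_vals
    m.2 i.
have qws i : wsmooth O1 (qw^~ i).
  apply: wsmoothD => //.
    apply: (prolong_wsmooth (V := cmap (coord_chart U x) @` U) (m := fun m :
      F => vals e m.1)) => //.
    - exact: vs.
    - by move=> m [].
    - by move=> k; exact: (chart_rep_smooth (w i) k Ax).
  apply: (vals_wsmooth _ _ (f := fun m : F => vec_mx m.2)) => //.
  move=> j k l; under eq_fun do rewrite vec_mxE; exact: Ck_snd.
pose O2 := O1 `&` (fun m => \row_i aug hA (qw m i)) @^-1` (cmap (coord_chart W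
  w) @` W).
have oO2 : open O2 by exact: open_aug_row.
have qwE (z : fibprod) : near_dom U (sval z).1 ->
    qw (cmap (fibprod_chart U x e W w) z) = fun i => pt (add_map z) (w i).
  move=> Uz; apply/funext => i; rewrite add_mapE /qw; congr (_ + _).
    by rewrite (prolong_chart_eval hA _ Ax eb Uz).
  by rewrite /= tangent_coordK// => f; exact: TV_ker.
pose g (m : F) : 'M[R]_(n, \dim {:A}) :=
  \matrix_(i, k) coord e' k (prolong hA (chart_rep (coord_chart W w) (y i)) (qw
    m)).
exists g.
  move=> k; apply: (@Ck_sub _ _ _ k O2).
    move=> _ [z [[[u Uu zu] [u' Wu' zu']] _] <-].
    have Uz : near_dom U (sval z).1 by exists u.
    have zu'' : near_point (pt (add_map z)) u'.
      by apply/near_add/(near_phihat hA hB).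
    split; last by rewrite /= qwE//; exists u' => //;
      rewrite (aug_row_point hA w zu'').
    split => //; exists u => //=.
    rewrite -[vals _ _]/(vals e (cmap (weil_chart U x e) (sval z).1))
      weil_chart_vals//.
    by rewrite (aug_row_point hA x zu).
  apply: (coord_wsmooth e' (f := fun m i =>
    prolong hA (chart_rep (coord_chart W w) (y i)) (qw m))) => // i.
  apply: (prolong_wsmooth (V := cmap (coord_chart W w) @` W) (m := qw)) => //.
  - by move=> j; apply: wsmooth_sub (qws j) => m [].
  - by move=> m [].
  - by move=> k'; exact: (chart_rep_smooth (y i) k' Aw).
move=> z [[Uz [u' Wu' zu']] _]; apply/matrixP => i k; rewrite !mxE;
  congr (coord e' k _).
have zu : near_point (pt (add_map z)) u' by apply/near_add/(near_phihat hA hB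
  phi).
by rewrite qwE// (prolong_eval hA Aw zu Wu').
Qed.

Lemma square_zero_affine : affine_bundle M phi.
Proof.
exists (TV phi (M := M)), (n * \dim I)%N, (@tangent_charts _ _ _ phi _ M);
  split.
- by move=> p; exact: derE.
- exact: tangent_vector_bundle.
- exists add_map; first exact: add_smooth.
  move=> z; split; last exact: phihat_add.
  by apply/funext => f; exact: add_mapE.
move=> b; split.
- have [p pb] := lift_point hA hB phi_surj b.
  by exists (point_fun p), p.
- move=> _ v [p pb <-] Tv; rewrite -pb in Tv.
  have [q [qE qp]] := add_point hA phi_surj I2 Tv.
  exists q; first by rewrite /= qp.
  by apply/funext => f; exact: qE.
- move=> _ _ [p pb <-] [q qb <-].
  have qp : phihat q = phihat p by rewrite pb qb.
  exists (point_fun q - point_fun p); split.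
    split; last by rewrite addrC subrK.
    by rewrite -pb; exact: (sub_points hA phi_surj I2 qp).
  by move=> v [_ ->]; rewrite addrAC subrr add0r.
Qed.

End affine_structure.

Section square_zero.
Context {R : realType} {A B : falgType R}
  (hA : weil_algebra A) (hB : weil_algebra B)
  (phi : {lrmorphism A -> B}) {n : nat} (M : manifold R n).
Local Notation I := (ker phi).

(** Compare the evaluation [p] at a point [u] with the A-point [q] whose first
    coordinate is moved by [a].  If [q - p] is a derivation, its value at the
    square of that coordinate is [2 x(u) a], whereas [q] and [p] differ there by
    [2 x(u) a + a ^+ 2]. *)
Lemma affine_sqr0 a : (0 < n)%N -> affine_bundle M phi -> a \in I -> a * a = 0.
Proof.
move=> n0 [TV' [r [vb [dE _ _ aff]]]] aI.
have [U [x [Ac Uu _]]] := coord_chart_ex (base_pt M); set u := base_pt M in Uu.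
pose i0 : 'I_n := Ordinal n0.
have [|p [pu px _]] := point_of_coords (hA := hA) Ac Uu (m := fun i =>
  (x i u : R)%:A).
  by move=> i; exact: aug_scalar.
have [|q [qu qx _]] := point_of_coords (hA := hA) Ac Uu
    (m := fun i => (x i u : R)%:A + (if i == i0 then a else 0)).
  move=> i; rewrite augD aug_scalar; case: ifP => _;
    last by rewrite linear0 addr0.
  by rewrite (aug_ker hA hB aI) addr0.
have phia : phi a = 0 by apply/eqP; rewrite -mem_ker.
have qp : weil_map phi (q : weil_bundle M A) = weil_map phi (p :
  weil_bundle M A).
  apply: (pt_eq_coords hB Ac Uu); try exact/(near_phihat hA hB).
  move=> i; rewrite !phihatE /pt qx px raddfD /=.
  by case: ifP => _; rewrite ?phia ?raddf0 addr0.
have [_ _ /(_ (point_fun p) (point_fun q))] := aff (weil_map phi (p :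
  weil_bundle M A)).
case; [by exists p|by exists q|move=> v [[Tv qE] _]].
have vE f : q f = p f + v f by exact: (congr1 (@^~ f) qE).
have va : v (x i0) = a.
  by apply: (addrI (p (x i0))); rewrite -vE qx px eqxx.
have [_ _ vM] : der (p : weil_bundle M A) I v by rewrite dE.
have := vE (x i0 * x i0); rewrite vM !pointM vE va.
rewrite mulrDl !mulrDr -!addrA => /addrI /addrI.
by rewrite (weilC hA a (p (x i0))) -{2}[p _ * a]addr0 => /addrI.
Qed.

(** Polarisation of [affine_sqr0]. *)
Lemma affine_square_zero : (0 < n)%N -> affine_bundle M phi ->
  (I ^+ 2)%VS = 0%VS.
Proof.
move=> n0 aff; apply/square_zeroP => a b aI bI.
have sq c : c \in I -> c * c = 0 by exact: affine_sqr0.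
have := sq _ (memvD aI bI).
rewrite mulrDl !mulrDr !sq// add0r addr0 (weilC hA b a) -mulr2n -scaler_nat =>
  /eqP.
by rewrite scaler_eq0 pnatr_eq0 => /eqP.
Qed.

End square_zero.

(* For n = 0 every fibre of M^A -> M^B is a point, and the addition law always
   gives an affine bundle; hence n > 0 in the second implication. *)
Theorem theorem3 (R : realType) (A B : falgType R)
    (hA : weil_algebra A) (hB : weil_algebra B)
    (phi : {lrmorphism A -> B}) (phi_surj : forall b : B, exists a :
      A, phi a = b)
    (n : nat) (M : manifold R n) :
  ((ker phi ^+ 2)%VS = 0%VS -> affine_bundle M phi) /\
  ((0 < n)%N -> affine_bundle M phi -> (ker phi ^+ 2)%VS = 0%VS).
Proof.
split; last exact: affine_square_zero.
move=> /square_zeroP I2; exact: (square_zero_affine hA hB phi_surj).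
Qed.
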